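(* For all $n\in\mathbb{N}_0$, $d\in\mathbb{N}$ and $\mathbf{s}=(s_1,\dots,s_d)\in\mathbb{N}^d$, and all real $y$ with $|y|<\pi/2$, \[ \sum_{n_1\ge n_2\ge \cdots \ge n_d\ge n} \frac{b_{n_1}(\sin y)}{(2n_1+1)^{s_1}\cdots (2n_d+1)^{s_d}} =\frac{d}{dy} \int_0^y h_{s_1}\circ \cdots\circ h_{s_d}\circ b_{n}(\sin t) \,dt . \] Consequently, for all real $x$ with $|x|<1$, \[ \sum_{n_1\ge \cdots \ge n_d\ge n} \frac{b_{n_1}(x)}{(2n_1+1)^{s_1}\cdots (2n_d+1)^{s_d}} = \sqrt{1-x^2}\, \frac{d}{dx} \int_0^x H_{s_1}\circ \cdots \circ H_{s_d}\circ b_{n}(t)\, \omega_1 . \]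
   Context: For $n\in\mathbb{N}_0$ put $b_n(x)=4^n\binom{2n}{n}^{-1}x^{2n}$ (with $\binom00=1$). Iterated integrals: for 1-forms $f_j(t)\,dt$, $\int_0^y f_1(t)dt\circ\cdots\circ f_p(t)dt:=\int_{y>t_1>\cdots>t_p>0} f_1(t_1)\cdots f_p(t_p)\,dt_1\cdots dt_p$ (oriented appropriately for $y<0$), extended multilinearly to formal sums of 1-forms; $(\alpha)^k$ denotes $\alpha\circ\cdots\circ\alpha$ ($k$ times), and $b_n(\sin t)\,dt$, $b_n(t)\omega_1$ are 1-forms. Trigonometric 1-forms: $h_1(t)=2\csc 2t\,dt$, and for $s\ge2$, $h_s(t)=\csc t\,dt\circ(\cot t\,dt)^{s-2}\circ \csc t\,dt$. Non-trigonometric 1-forms: $\omega_0=\frac{dt}{t}$, $\omega_1=\frac{dt}{\sqrt{1-t^2}}$, $\omega_2=\frac{t\,dt}{1-t^2}$, $\omega_3=\frac{dt}{t\sqrt{1-t^2}}$; $H_1=\omega_0+\omega_2$ and for $s\ge2$, $H_s=\omega_3\circ\omega_0^{s-2}\circ\omega_3$. *)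

(* Defs.v *)
From HB Require Import structures.
From mathcomp Require Import all_boot all_order all_algebra.
From mathcomp Require Import all_classical all_reals all_analysis.

Set Implicit Arguments.
Unset Strict Implicit.
Unset Printing Implicit Defensive.

Import Order.TTheory GRing.Theory Num.Theory.
Import numFieldNormedType.Exports.

Local Open Scope classical_set_scope.
Local Open Scope ring_scope.

Section lebesgue_tuple.
Variable R : realType.
Local Notation RM := (measurableTypeR R).

Definition cons_pair (p : nat) (z : RM * p.-tuple RM) : p.+1.-tuple RM :=
  [tuple of z.1 :: z.2].

Lemma measurable_cons_pair p : measurable_fun setT (@cons_pair p).
Proof. exact: measurable_cons. Qed.

Lemma measurable_uncons_pair p :
  measurable_fun setT
    (fun t : p.+1.-tuple RM => (thead t, [tuple of behead t])).
Proof.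
apply: measurable_fun_pair; last exact: measurable_behead.
exact: measurable_tnth.
Qed.

Section cons_measure.
Variables (p : nat) (mu : {sigma_finite_measure set (p.-tuple RM) -> \bar R}).

Definition cons_measure : set (p.+1.-tuple RM) -> \bar R :=
  pushforward (@lebesgue_measure R \x mu)%E (@cons_pair p).

Let cons_measure0 : cons_measure set0 = 0%E.
Proof. by rewrite /cons_measure /pushforward preimage_set0 measure0. Qed.

Let cons_measure_ge0 A : (0 <= cons_measure A)%E.
Proof. by rewrite /cons_measure /pushforward; exact: measure_ge0. Qed.

Let cons_measure_sigma_additive : semi_sigma_additive cons_measure.
Proof.
move=> F mF tF mUF; rewrite /cons_measure /pushforward preimage_bigcup.
apply: measure_semi_sigma_additive.
- by move=> n; rewrite -[X in measurable X]setTI; exact: measurable_cons_pair.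
- apply/trivIsetP => i j _ _ ij; rewrite -preimage_setI.
  by move/trivIsetP : tF => /(_ _ _ _ _ ij) ->//; rewrite preimage_set0.
- rewrite -preimage_bigcup -[X in measurable X]setTI.
  exact: measurable_cons_pair.
Qed.

HB.instance Definition _ := isMeasure.Build _ _ _ cons_measure
  cons_measure0 cons_measure_ge0 cons_measure_sigma_additive.

Let cons_measure_sigma_finite : sigma_finite setT cons_measure.
Proof.
have /sigma_finiteP[F [FT ndF Foo]] := sigma_finiteT (@lebesgue_measure R).
have /sigma_finiteP[G [GT ndG Goo]] := sigma_finiteT mu.
pose u (t : p.+1.-tuple RM) := (thead t, [tuple of behead t]).
exists (fun k => u @^-1` (F k `*` G k)) => [|k].
  apply/esym; rewrite -subTset => t _.
  have [i _ Fi] : (\bigcup_i F i) (thead t) by rewrite -FT.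
  have [j _ Gj] : (\bigcup_j G j) [tuple of behead t] by rewrite -GT.
  exists (maxn i j) => //; split => /=.
    by move: Fi; exact/subsetPset/ndF/leq_maxl.
  by move: Gj; exact/subsetPset/ndG/leq_maxr.
have [mF Fk] := Foo k; have [mG Gk] := Goo k; split.
  rewrite -[X in measurable X]setTI.
  by apply: measurable_uncons_pair => //; exact: measurableX.
rewrite /cons_measure /pushforward -comp_preimage.
have -> : u \o @cons_pair p = id.
  by apply/funext => -[x t]; rewrite /u /= theadE; congr pair; exact: val_inj.
by rewrite preimage_id product_measure1E// lte_mul_pinfty// ge0_fin_numE.
Qed.

HB.instance Definition _ := Measure_isSigmaFinite.Build _ _ _ cons_measure
  cons_measure_sigma_finite.

End cons_measure.

(* Lebesgue measure on R^p, with R^p represented by p.-tuple R. *)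
Fixpoint lebesgue_tuple (p : nat) :
    {sigma_finite_measure set (p.-tuple RM) -> \bar R} :=
  match p with
  | 0 => \d_([tuple] : 0.-tuple RM)
  | q.+1 => cons_measure (lebesgue_tuple q)
  end.

End lebesgue_tuple.

Section iterated_integral.
Variable R : realType.

(* The 1-form f(t) dt is represented by f.  A word [:: f1; ...; fp] stands for
   f1 dt o ... o fp dt, and a sequence of words for their formal sum. *)
Definition form := R -> R.
Definition word := seq form.
Definition formal_sum := seq word.

Definition single (f : form) : formal_sum := [:: [:: f]].

(* The bilinear extension of concatenation. *)
Definition fcompose (A B : formal_sum) : formal_sum :=
  [seq u ++ v | u <- A, v <- B].

(* {y > t_1 > ... > t_p > 0} if 0 <= y, and {y < t_1 < ... < t_p < 0} if y < 0 *)
Definition simplex (p : nat) (y : R) : set (p.-tuple (measurableTypeR R)) :=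
  [set t | if 0 <= y then path >%R y (rcons (t : seq R) 0)
           else path <%R y (rcons (t : seq R) 0)].

Definition word_integrand (w : word)
    (t : (size w).-tuple (measurableTypeR R)) : R :=
  \prod_(ft <- zip w (t : seq R)) ft.1 ft.2.

Definition word_integrable (w : word) (y : R) : Prop :=
  (lebesgue_tuple R (size w)).-integrable (simplex y)
    (EFin \o @word_integrand w).

(* Each of the p successive integrations changes sign when y < 0. *)
Definition word_integral (w : word) (y : R) : R :=
  (if 0 <= y then 1 else (-1) ^+ size w) *
  \int[lebesgue_tuple R (size w)]_(t in simplex y) word_integrand t.

Definition iterated_integrable (A : formal_sum) (y : R) : Prop :=
  forall w, w \in A -> word_integrable w y.

Definition iterated_integral (A : formal_sum) (y : R) : R :=
  \sum_(w <- A) word_integral w y.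

End iterated_integral.

Section forms.
Variable R : realType.

Definition b (n : nat) (x : R) : R := 4 ^+ n / 'C(2 * n, n)%:R * x ^+ (2 * n).

Definition csc (t : R) : R := (sin t)^-1.
Definition cot (t : R) : R := cos t / sin t.

Definition h (s : nat) : formal_sum R :=
  if s == 1%N then single (fun t => 2 * csc (2 * t))
  else [:: csc :: nseq (s - 2) cot ++ [:: csc]].

Definition omega0 (t : R) : R := t^-1.
Definition omega1 (t : R) : R := (Num.sqrt (1 - t ^+ 2))^-1.
Definition omega2 (t : R) : R := t / (1 - t ^+ 2).
Definition omega3 (t : R) : R := (t * Num.sqrt (1 - t ^+ 2))^-1.

Definition H (s : nat) : formal_sum R :=
  if s == 1%N then single omega0 ++ single omega2
  else [:: omega3 :: nseq (s - 2) omega0 ++ [:: omega3]].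

(* h_{s_1} o ... o h_{s_d} o b_n(sin t) dt *)
Definition trig_form (s : seq nat) (n : nat) : formal_sum R :=
  foldr (fun si => fcompose (h si)) (single (fun t => b n (sin t))) s.

(* H_{s_1} o ... o H_{s_d} o b_n(t) omega_1 *)
Definition nontrig_form (s : seq nat) (n : nat) : formal_sum R :=
  foldr (fun si => fcompose (H si)) (single (fun t => b n t * omega1 t)) s.

(* The sum over all n_1 >= ... >= n_d >= n, as an extended real; all terms are
   nonnegative since b_m(x) is a nonnegative multiple of x^(2m).  For d > 0,
   [head n k] is n_1. *)
Definition nested_sum (d : nat) (s : d.-tuple nat) (n : nat) (x : R) : \bar R :=
  \esum_(k in [set k : d.-tuple nat | sorted geq (rcons k n)])
    (b (head n k) x /
     \prod_(i < d) (2 * tnth k i + 1)%:R ^+ tnth s i)%:E.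

End forms.

(* Main.v *)
(** Both identities are instances of one computation.  Let [x], [c], [om] satisfy
    [x' = c om], [c' = - x om] and [x^2 + c^2 = 1]; the trigonometric case is
    [(sin, cos, 1)] and the other one is [(t, sqrt (1 - t^2), omega1)].  In both
    cases the 1-forms are [om / (x c)] for s = 1, [om / x] and [c om / x] for
    s >= 2, and [b_n(x) om] at the end of the word.

    Since [(x^(2m+1) c)'] is a combination of [b_m(x) om] and [b_{m+1}(x) om],
    telescoping gives
      [\int_0^y b_m(x) om = x c \sum_{k >= m} b_k(x) / (2k+1)],
    and termwise integration gives
      [\int_0^y c om \sum_k a_k b_k(x) = x \sum_k a_k b_k(x) / (2k+1)].
    Hence prefixing the word by [H_s] replaces a series [\sum_k a_k b_k] by
      [\sum_k (a_0 + ... + a_k) / (2k+1)^s b_k],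
    which is the recursion of the nested sums.  On [y > 0] all forms are
    nonnegative, so Tonelli and monotone convergence need no side condition;
    negative [y] follow by parity, and the derivative is the fundamental theorem
    of calculus for the continuous function [om \sum_k a_k b_k(x)]. *)
Require Import Defs.
From HB Require Import structures.
From mathcomp Require Import all_boot all_order all_algebra.
From mathcomp Require Import all_classical all_reals all_analysis.
From mathcomp Require Import measurable_realfun zify lra ring.
Set Implicit Arguments.
Unset Strict Implicit.
Unset Printing Implicit Defensive.
Import Order.TTheory GRing.Theory Num.Theory.
Import numFieldNormedType.Exports.
Local Open Scope classical_set_scope.
Local Open Scope ring_scope.


(** * Tonelli on simplices *)

Section words.
Variable R : realType.
Local Notation RM := (measurableTypeR R).
Local Notation mu := (@lebesgue_measure R).

(** The range of the outermost variable of the oriented simplex; it is empty for [y = 0]. *)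
Definition seg (y : R) : set R :=
  if 0 <= y then [set` `]0, y[] else [set` `]y, 0[].

Lemma path_gt0 (y : R) s : path >%R y (rcons s 0) -> 0 < y.
Proof.
elim: s y => [|x s ih] y /=; first by rewrite andbT.
by move=> /andP[xy /ih x0]; exact: lt_trans xy.
Qed.

Lemma path_lt0 (y : R) s : path <%R y (rcons s 0) -> y < 0.
Proof.
elim: s y => [|x s ih] y /=; first by rewrite andbT.
by move=> /andP[xy /ih x0]; exact: lt_trans x0.
Qed.

(** A strict chain ending at 0 has entries of constant sign, so the sign tests at [y] and at [x]
    select the same branch, and peeling off the outermost variable leaves a simplex based at it. *)
Lemma simplex_cons p (y x : R) (t : p.-tuple RM) :
  simplex y (cons_pair (x, t)) <-> seg y x /\ simplex x t.
Proof.
rewrite /simplex /seg /=; case: (leP 0 y) => y0 /=; rewrite in_itv/=.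
  split=> [/andP[xy /[dup] /path_gt0 x0 xt]|[/andP[x0 ->]]].
    by rewrite xy x0 (ltW x0).
  by rewrite (ltW x0).
split=> [/andP[yx /[dup] /path_lt0 x0 xt]|[/andP[-> x0]]].
  by rewrite yx x0 leNgt x0.
by rewrite leNgt x0.
Qed.

Lemma segP (y x : R) : seg y x <-> (0 < x /\ x < y) \/ (y < x /\ x < 0).
Proof.
rewrite /seg; case: (leP 0 y) => y0 /=; rewrite in_itv/=.
  by split=> [/andP[]|]; [left|case=> -[? ?]; apply/andP; split => //; lra].
by split=> [/andP[]|]; [right|case=> -[? ?]; apply/andP; split => //; lra].
Qed.

Lemma segN (y x : R) : seg y (- x) <-> seg (- y) x.
Proof. by split=> /segP[] [? ?]; apply/segP; [right|left|right|left]; lra. Qed.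

Lemma measurable_seg y : measurable (seg y).
Proof. by rewrite /seg; case: ifP => _; exact: measurable_itv. Qed.

Lemma measurable_lt_set d (T : measurableType d) (f g : T -> RM) :
  measurable_fun setT f -> measurable_fun setT g ->
  measurable [set z | f z < g z].
Proof.
move=> mf mg; have := measurable_fun_ltr mf mg.
by move=> /(_ measurableT [set true] I); rewrite setTI.
Qed.

Lemma measurable_seg_graph : measurable [set z : RM * RM | seg z.1 z.2].
Proof.
rewrite (_ : [set z | _] =
    ([set z | 0 < z.2] `&` [set z | z.2 < z.1]) `|`
    ([set z | z.1 < z.2] `&` [set z | z.2 < 0])).
  by apply: measurableU; apply: measurableI; apply: measurable_lt_set.
by apply/seteqP; split => -[y x] /segP.
Qed.

(** Joint measurability in the base point and the tuple is what makes the iterated integral a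
    measurable function of its upper limit. *)
Lemma measurable_simplex_graph p :
  measurable [set z : RM * p.-tuple RM | simplex z.1 z.2].
Proof.
elim: p => [|p ih].
  (* In dimension 0 the chain reduces to [y > 0] or [y < 0], so the graph is the set where [y] is
     nonzero. *)
  rewrite (_ : [set z | _] = [set z | (0:R) < z.1] `|` [set z | z.1 < 0]).
    by apply: measurableU; apply: measurable_lt_set.
  apply/seteqP; split => -[y t] /=; rewrite /simplex/= tuple0/= !andbT.
    by case: (leP 0 y) => y0 ?; [left|right].
  by case=> y0; [rewrite (ltW y0)|rewrite leNgt y0].
rewrite (_ : [set z | _] =
  (fun z : RM * p.+1.-tuple RM => (z.1, thead z.2)) @^-1`
     [set z : RM * RM | seg z.1 z.2] `&`
  (fun z : RM * p.+1.-tuple RM => (thead z.2, [tuple of behead z.2])) @^-1`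
     [set z : RM * p.-tuple RM | simplex z.1 z.2]).
  apply: measurableI; rewrite -[X in measurable X]setTI.
  - suff m : measurable_fun setT
        (fun z : RM * p.+1.-tuple RM => (z.1, thead z.2)).
      by apply: m => //; exact: measurable_seg_graph.
    apply: measurable_fun_pair => //.
    by apply: measurableT_comp => //; exact: measurable_tnth.
  - suff m : measurable_fun setT
      (fun z : RM * p.+1.-tuple RM => (thead z.2, [tuple of behead z.2])).
      exact: m.
    exact: (measurableT_comp (@measurable_uncons_pair R p)).
apply/seteqP; split => -[y t] /=.
  by rewrite {1}(tuple_eta t) => /(simplex_cons y (thead t) (behead_tuple t)).
move=> H; rewrite (tuple_eta t).
by apply/(simplex_cons y (thead t) (behead_tuple t)).
Qed.

Lemma measurable_simplex p y : measurable (@simplex R p y).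
Proof.
rewrite (_ : simplex y =
  (pair y) @^-1` [set z : RM * p.-tuple RM | simplex z.1 z.2])//.
rewrite -[X in measurable X]setTI.
have m : measurable_fun setT (pair y : p.-tuple RM -> RM * p.-tuple RM).
  exact: measurable_pair1.
by apply: m => //; exact: measurable_simplex_graph.
Qed.

Lemma word_integrand_cons (f : R -> R) (w : word R) x (t : (size w).-tuple RM) :
  @word_integrand R (f :: w) (cons_pair (x, t)) = f x * word_integrand t.
Proof. by rewrite /word_integrand /= big_cons. Qed.

Definition measurable_word (w : word R) :=
  forall f, f \in w -> measurable_fun setT (f : RM -> RM).

Lemma measurable_word_cons f w : measurable_word (f :: w) ->
  measurable_fun setT (f : RM -> RM) /\ measurable_word w.
Proof.
move=> m; split; first by apply: m; rewrite mem_head.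
by move=> g gw; apply: m; rewrite in_cons gw orbT.
Qed.

Lemma measurable_word_integrand (w : word R) : measurable_word w ->
  measurable_fun setT (@word_integrand R w).
Proof.
elim: w => [_|f w ih /measurable_word_cons[mf /ih mw]].
  rewrite (_ : @word_integrand R [::] = cst 1) //.
  by apply/funext => t; rewrite (tuple0 t) /word_integrand big_nil.
rewrite (_ : @word_integrand R (f :: w) = fun t : (size w).+1.-tuple RM =>
    f (thead t) * @word_integrand R w [tuple of behead t]).
  apply: measurable_funM.
    by apply: measurableT_comp => //; exact: measurable_tnth.
  by apply: measurableT_comp => //; exact: measurable_behead.
apply/funext => t; rewrite [in LHS](tuple_eta t).
exact: (word_integrand_cons f (thead t) (behead_tuple t)).
Qed.

Local Open Scope ereal_scope.

(* Taking absolute values makes every integral below nonnegative, so that Tonelli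
   applies without any integrability hypothesis. *)
Definition abs_integral (w : word R) (y : R) : \bar R :=
  \int[lebesgue_tuple R (size w)]_(t in simplex y) `|word_integrand t|%:E.

Lemma abs_integral_ge0 w y : 0 <= abs_integral w y.
Proof. by apply: integral_ge0 => t _; rewrite lee_fin. Qed.

(** The measure is a Dirac mass at the empty tuple. The value [y = 0] is excluded because the strict
    chain then makes even the 0-dimensional simplex empty. *)
Lemma abs_integral_nil y : y != 0%R -> abs_integral [::] y = 1.
Proof.
move=> y0; rewrite /abs_integral (@integral_dirac _ _ [tuple]); last 2 first.
- exact: measurable_simplex.
- apply: measurable_funTS; apply/measurable_EFinP.
  apply: measurableT_comp => //.
  by apply: (@measurable_word_integrand [::]) => f; rewrite in_nil.
rewrite diracE mem_set ?mul1e /word_integrand ?big_nil ?normr1//.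
by rewrite /simplex/= !andbT; case: (ltgtP 0%R y) y0 => // ->; rewrite eqxx.
Qed.

(** The measure on tuples is the image of a product measure under [cons_pair], so a change of
    variables followed by Tonelli integrates the outermost variable last. *)
Lemma abs_integral_cons f w y : measurable_word (f :: w) ->
  abs_integral (f :: w) y = \int[mu]_(x in seg y) (`|f x|%:E * abs_integral w x).
Proof.
move=> mfw; have [mf mw] := measurable_word_cons mfw.
have mi := measurable_word_integrand mfw.
have mabs : measurable_fun setT
    (fun t : (size w).+1.-tuple RM => `|@word_integrand R (f :: w) t|%:E).
  by apply/measurable_EFinP; exact: measurableT_comp mi.
(* The integrand is extended by 0 outside the simplex, so that Tonelli applies on the full product
   space. *)
pose g (z : RM * (size w).-tuple RM) :=
  ((EFin \o (fun t => `|@word_integrand R (f :: w) (cons_pair t)|%R))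
     \_ (@cons_pair R (size w) @^-1` simplex y)) z.
rewrite /abs_integral /=.
rewrite (@ge0_integral_pushforward _ _ _ _ _ (@cons_pair R (size w))
  (@measurable_cons_pair R (size w)) (mu \x lebesgue_tuple R (size w)))//;
  last 2 first.
- exact: measurable_simplex.
- exact: measurable_funTS.
rewrite integral_mkcond -/g.
rewrite (@fubini_tonelli1 _ _ _ _ _ mu (lebesgue_tuple R (size w)) g); last 2 first.
- apply/(measurable_restrictT _ _).1.
    rewrite -[X in measurable X]setTI; apply: measurable_cons_pair => //.
    exact: measurable_simplex.
  apply: measurable_funTS; apply: (measurableT_comp mabs).
  exact: measurable_cons_pair.
- by move=> z; rewrite /g patchE; case: ifP => // _; rewrite lee_fin.
rewrite [RHS]integral_mkcond; apply: eq_integral => x _.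
rewrite /fubini_F patchE; case: ifPn => xy.
  rewrite -ge0_integralZl//; last 2 first.
  - exact: measurable_simplex.
  - apply: measurable_funTS; apply/measurable_EFinP; apply: measurableT_comp => //.
    exact: measurable_word_integrand.
  rewrite [RHS]integral_mkcond; apply: eq_integral => t _.
  rewrite /g !patchE; case: ifPn => xt; case: ifPn => xt'.
  - by rewrite /= word_integrand_cons normrM EFinM.
  - by move: xt xt'; rewrite inE notin_setE /= => /simplex_cons[].
  - move: xt xt'; rewrite inE notin_setE /= => /simplex_cons H1 H2.
    by exfalso; apply: H1; split => //; exact: set_mem.
  - by [].
rewrite integral0_eq// => t _; rewrite /g patchE; case: ifPn => // xt.
move: xt; rewrite inE /= => /simplex_cons[xy'].
by move: xy; rewrite notin_setE.
Qed.

Lemma measurable_abs_integral w : measurable_word w ->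
  measurable_fun setT (abs_integral w : RM -> \bar R).
Proof.
move=> mw.
pose g (z : RM * (size w).-tuple RM) :=
  ((EFin \o (fun z => `|@word_integrand R w z.2|%R))
     \_ [set z : RM * (size w).-tuple RM | simplex z.1 z.2]) z.
rewrite (_ : abs_integral w = fubini_F (lebesgue_tuple R (size w)) g).
  apply: measurable_fun_fubini_tonelli_F.
  - apply/(measurable_restrictT _ _).1; first exact: measurable_simplex_graph.
    apply: measurable_funTS; apply/measurable_EFinP; apply: measurableT_comp => //.
    by apply: measurableT_comp => //; exact: measurable_word_integrand.
  - by move=> z; rewrite /g patchE; case: ifP => // _; rewrite lee_fin.
apply/funext => y; rewrite /abs_integral /fubini_F [LHS]integral_mkcond.
apply: eq_integral => t _; rewrite /g !patchE.
by congr (if _ then _ else _); apply/idP/idP; rewrite !inE.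
Qed.

(** Invariance of Lebesgue measure under [t -> - t]. *)
Lemma integral_segN (g : R -> \bar R) y : measurable_fun setT (g : RM -> \bar R) ->
  (forall x, 0 <= g x) -> (forall x, g (- x)%R = g x) ->
  \int[mu]_(x in seg (- y)) g x = \int[mu]_(x in seg y) g x.
Proof.
move=> mg g0 gN.
rewrite (_ : seg (- y) = (-%R : RM -> RM) @^-1` seg y); last first.
  by apply/seteqP; split => x /segN.
transitivity (\int[mu]_(x in (-%R : RM -> RM) @^-1` seg y) (g \o -%R) x).
  by apply: eq_integral => x _ /=; rewrite gN.
rewrite -ge0_integral_pushforward//; last 2 first.
- exact: measurable_seg.
- exact: measurable_funTS.
by apply: eq_measure_integral => //= A mA AS; exact: lebesgue_measureN.
Qed.

Lemma abs_integralN w y : measurable_word w ->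
  (forall f, f \in w -> forall x, `|f (- x)| = `|f x|)%R ->
  abs_integral w (- y)%R = abs_integral w y.
Proof.
elim: w y => [|f w ih] y mw fN.
  have [->|y0] := eqVneq y 0%R; first by rewrite oppr0.
  by rewrite !abs_integral_nil// oppr_eq0.
have [mf mw'] := measurable_word_cons mw.
rewrite !abs_integral_cons// integral_segN//.
- apply: emeasurable_funM; last exact: measurable_abs_integral.
  by apply/measurable_EFinP; exact: measurableT_comp.
- by move=> x; rewrite mule_ge0// ?lee_fin// abs_integral_ge0.
- move=> x; rewrite fN ?mem_head// ih// => g gw; apply: fN.
  by rewrite in_cons gw orbT.
Qed.

Lemma segE y : (0 <= y)%R -> seg y = `]0%R, y[%classic.
Proof. by rewrite /seg => ->. Qed.

End words.

(** * Series in the b_k *)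

Section bseries.
Variable R : realType.

Definition bcoef (m : nat) : R := 4 ^+ m / 'C(2 * m, m)%:R.

Lemma bE m (z : R) : b m z = bcoef m * z ^+ (2 * m).
Proof. by []. Qed.

Lemma bcoef_gt0 m : 0 < bcoef m.
Proof.
by rewrite /bcoef divr_gt0 ?exprn_gt0 ?ltr0n// bin_gt0 leq_pmull.
Qed.

(** Two absorption identities, linked through ['C(2m+1, m)]. *)
Lemma central_binS m :
  (m.+1 * 'C(2 * m.+1, m.+1) = 'C(2 * m, m) * (2 * (2 * m).+1))%N.
Proof.
have e1 := mul_bin_diag (2 * m).+2 m.
have e2 := mul_bin_down (2 * m).+1 m.
have e3 : ((2 * m).+1 - m = m.+1)%N by rewrite mul2n -addnn -addnS addKn.
rewrite mulnS -e1 /=; rewrite e3 /= in e2.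
have -> : ((2 * m).+2 = 2 * m.+1)%N by rewrite mulnS.
by rewrite -mulnA -e2; ring.
Qed.

(** This ratio of consecutive coefficients is exactly the one that makes the derivative in
    [integral_bS] telescope. *)
Lemma bcoefS m : bcoef m.+1 * (2 * m + 1)%:R = bcoef m * (2 * m + 2)%:R.
Proof.
have := congr1 (fun k => k%:R : R) (central_binS m).
rewrite /bcoef exprS !natrM addn1 addn2.
have h0 k : (k.+1%:R : R) != 0 by rewrite pnatr_eq0.
have c0 k : ('C(2 * k, k)%:R : R) != 0.
  by rewrite pnatr_eq0 -lt0n bin_gt0 leq_pmull.
move=> e.
have {}e : 'C(2 * m.+1, m.+1)%:R =
    'C(2 * m, m)%:R * (2 * (2 * m).+1%:R) / m.+1%:R :> R.
  by rewrite -e mulrC mulKf.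
rewrite e (_ : (2 * m).+2%:R = 2 * m.+1%:R :> R); last first.
  by rewrite -natrM mulnS.
by field; rewrite c0 -natrM !nat1r !h0.
Qed.

(** A crude linear bound, enough for geometric decay to win in [cvg_b0]. *)
Lemma bcoef_le m : bcoef m <= (2 * m + 1)%:R.
Proof.
elim: m => [|m ih]; first by rewrite /bcoef expr0 bin0 divr1.
have p0 : (0 : R) < (2 * m + 1)%:R by rewrite ltr0n addn1.
rewrite -(ler_pM2r p0) bcoefS.
apply: (le_trans (ler_wpM2r _ ih)) => //.
by rewrite mulrC ler_wpM2r ?ler0n// ler_nat mulnS; lia.
Qed.

Lemma b0 (z : R) : b 0 z = 1.
Proof. by rewrite bE expr0 mulr1 /bcoef expr0 bin0 divr1. Qed.

Lemma b_ge0 m (z : R) : 0 <= b m z.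
Proof. by rewrite bE mulr_ge0 ?(ltW (bcoef_gt0 _))// exprM exprn_ge0// sqr_ge0. Qed.

Lemma b_norm m (z : R) : b m `|z| = b m z.
Proof. by rewrite !bE !exprM real_normK// num_real. Qed.

Lemma le_b m (z1 z2 : R) : `|z1| <= `|z2| -> b m z1 <= b m z2.
Proof.
move=> z12; rewrite -b_norm -(b_norm m z2) !bE ler_wpM2l ?(ltW (bcoef_gt0 _))//.
by rewrite lerXn2r// nnegrE.
Qed.

Lemma cvg_b0 (z : R) : 0 <= z < 1 -> b m z @[m --> \oo] --> 0.
Proof.
move=> /andP[z0 z1].
(* [k z^k <= 1 + z + ... + z^(k-1)], since each term is at least [z^k] *)
have zn k : k%:R * z ^+ k <= (1 - z)^-1.
  rewrite -[leRHS]mul1r ler_pdivlMr ?subr_gt0//.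
  have : (1 - z) * \sum_(i < k) z ^+ i = 1 - z ^+ k.
    rewrite -[1 in RHS](expr1n _ k) subrXX; congr (_ * _).
    by apply: eq_bigr => i _; rewrite expr1n mul1r.
  have : k%:R * z ^+ k <= \sum_(i < k) z ^+ i.
    rewrite mulr_natl -[k in _ *+ k]card_ord -sumr_const; apply: ler_sum => i _.
    by apply: ler_wiXn2l => //; [exact: ltW|exact: ltnW].
  move=> h1 h2; have := ler_wpM2l (_ : 0 <= 1 - z) h1.
  rewrite subr_ge0 (ltW z1) h2 => /(_ isT) h3.
  rewrite mulrC (le_trans h3)// lerBlDr lerDl exprn_ge0//.
(* In [z^(2m) = z^m z^m] one factor absorbs the linear growth of the coefficient, by [zn], and the
   other tends to 0. *)
apply: (@squeeze_cvgr _ _ _ _ (fun=> 0) (fun m => (2 * (1 - z)^-1 + 1) * z ^+ m)).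
- near=> m; rewrite b_ge0/= bE.
  apply: (@le_trans _ _ ((2 * m + 1)%:R * z ^+ (2 * m))).
    by rewrite ler_wpM2r ?exprn_ge0 ?bcoef_le.
  rewrite mul2n -addnn exprD mulrA ler_wpM2r ?exprn_ge0//.
  rewrite addnn -mul2n natrD natrM mulrDl -mulrA mul1r lerD//.
    by rewrite ler_wpM2l.
  by rewrite exprn_ile1// ltW.
- exact: cvg_cst.
- rewrite -[X in _ --> X](mulr0 (2 * (1 - z)^-1 + 1)).
  by apply: cvgMr; apply: cvg_expr; rewrite ger0_norm.
Unshelve. all: by end_near. Qed.

Local Open Scope ereal_scope.

(** Values are extended reals, so that for nonnegative coefficients sums and integrals can be
    exchanged before convergence is known. *)
Definition bseries (a : nat -> R) (z : R) : \bar R :=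
  \sum_(k <oo) (a k * b k z)%:E.

Definition nneg (a : nat -> R) := forall k, (0 <= a k)%R.

Lemma bseries_term_ge0 a z k : nneg a -> 0 <= (a k * b k z)%:E.
Proof. by move=> a0; rewrite lee_fin mulr_ge0 ?b_ge0. Qed.

Lemma bseries_ge0 a z : nneg a -> 0 <= bseries a z.
Proof. by move=> a0; apply: nneseries_ge0 => k _ _; exact: bseries_term_ge0. Qed.

Lemma le_bseries a z1 z2 : nneg a -> (`|z1| <= `|z2|)%R ->
  bseries a z1 <= bseries a z2.
Proof.
move=> a0 z12; apply: lee_nneseries => k *; first exact: bseries_term_ge0.
by rewrite lee_fin ler_wpM2l// le_b.
Qed.

Definition odd_div (s : nat) (a : nat -> R) (k : nat) : R :=
  (a k / (2 * k + 1)%:R ^+ s)%R.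

Definition partial_sum (a : nat -> R) (k : nat) : R := (\sum_(m < k.+1) a m)%R.

Lemma odd_div_ge0 s a : nneg a -> nneg (odd_div s a).
Proof. by move=> a0 k; rewrite /odd_div mulr_ge0// invr_ge0 exprn_ge0. Qed.

Lemma partial_sum_ge0 a : nneg a -> nneg (partial_sum a).
Proof. by move=> a0 k; apply: sumr_ge0. Qed.

Lemma odd_divD s t a : odd_div s (odd_div t a) = odd_div (t + s) a.
Proof. by apply/funext => k; rewrite /odd_div exprD invfM mulrA. Qed.

Lemma odd_div0 a : odd_div 0 a = a.
Proof. by apply/funext => k; rewrite /odd_div expr0 divr1. Qed.

Lemma measurable_bseries d (T : measurableType d) (D : set T) a (f : T -> R) :
  nneg a -> measurable_fun D f -> measurable_fun D (fun t => bseries a (f t)).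
Proof.
move=> a0 mf; apply: 
  (@ge0_emeasurable_sum _ _ _ D (fun k t => (a k * b k (f t))%:E) xpredT).
  by move=> k t _ _; exact: bseries_term_ge0.
move=> k _; apply/measurable_EFinP; apply: measurable_funM => //.
rewrite /b; apply: measurable_funM => //.
exact: measurable_funX.
Qed.

(** After a double sum over [k <= j] has been interchanged, the inner sum over [k] has this form,
    with the range encoded by an indicator. *)
Lemma nneseries_partial_sum a j (u : \bar R) : nneg a -> 0 <= u ->
  \sum_(k <oo) (u * (a k * (k <= j)%N%:R)%:E) = u * (partial_sum a j)%:E.
Proof.
move=> a0 u0; have v0 k : 0 <= (a k * (k <= j)%N%:R)%:E by rewrite lee_fin mulr_ge0.
rewrite (nneseries_split 0 j.+1); last by move=> k _; rewrite mule_ge0.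
rewrite add0n [X in _ + X]eseries0 ?adde0; last first.
  by move=> k jk _; rewrite leqNgt jk mulr0 mule0.
rewrite -ge0_sume_distrr//; congr (_ * _).
rewrite big_mkord sumEFin; congr EFin; apply: eq_bigr => k _.
by rewrite -ltnS ltn_ord mulr1.
Qed.

End bseries.

(** * Integrals along a rotation *)

Section FTC_open.
Variable R : realType.
Local Notation mu := (@lebesgue_measure R).
Local Open Scope ereal_scope.

Lemma is_derive_continuous (F : R -> R) (t df : R) : is_derive t 1%R F df ->
  {for t, continuous F}.
Proof.
move=> [dF _]; apply: differentiable_continuous; exact/derivable1_diffP.
Qed.

Lemma continuous_itv_integrable (f : R -> R) (y : R) :
  (forall t, (0 <= t <= y)%R -> {for t, continuous f}) ->
  mu.-integrable `[0%R, y] (EFin \o f).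
Proof.
move=> cf; apply: continuous_compact_integrable; first exact: segment_compact.
apply: continuous_in_subspaceT => t; rewrite inE/= in_itv/=; exact: cf.
Qed.

Lemma continuous_itv_measurable (f : R -> R) (y : R) :
  (forall t, (0 <= t <= y)%R -> {for t, continuous f}) ->
  measurable_fun `]0%R, y[ f.
Proof.
move=> cf; apply: open_continuous_measurable_fun => // t.
by rewrite inE/= in_itv/= => /andP[/ltW t0 /ltW ty]; apply: cf; rewrite t0.
Qed.

(** The fundamental theorem of calculus on [[0, y]]; dropping the two endpoints does not change the
    integral. *)
Lemma integral_derive (F f : R -> R) (y : R) : (0 < y)%R ->
  (forall t : R, (0 <= t <= y)%R -> is_derive t 1%R F (f t)) ->
  (forall t, (0 <= t <= y)%R -> {for t, continuous f}) ->
  \int[mu]_(t in `]0%R, y[) (f t)%:E = (F y - F 0)%:E.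
Proof.
move=> y0 dF cf; rewrite -(@integral_itv_bndoo _ _ _ _ true false); last first.
  by apply/measurable_EFinP; exact: continuous_itv_measurable.
rewrite (@continuous_FTC2 _ f F)//.
- apply: continuous_in_subspaceT => t; rewrite inE/= in_itv/=; exact: cf.
- split.
  + by move=> t; rewrite in_itv/= => /andP[/ltW t0 /ltW ty]; case: (dF t); rewrite ?t0.
  + apply: cvg_at_right_filter; apply: (is_derive_continuous (dF _ _)).
    by rewrite lexx ltW.
  + apply: cvg_at_left_filter; apply: (is_derive_continuous (dF _ _)).
    by rewrite lexx ltW.
- move=> t; rewrite in_itv/= => /andP[/ltW t0 /ltW ty].
  by rewrite derive1E; apply: derive_val; apply: dF; rewrite t0.
Qed.

End FTC_open.

Section rotation.
Variable R : realType.
Local Notation mu := (@lebesgue_measure R).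

(* [(x, c)] moves on the unit circle with angular speed [om]. *)
Record rotation (Y : R) (x c om : R -> R) : Prop := Rotation {
  rot_dx : forall t : R, `|t| < Y -> is_derive t 1 x (c t * om t) ;
  rot_dc : forall t : R, `|t| < Y -> is_derive t 1 c (- (x t * om t)) ;
  rot_om : forall t : R, `|t| < Y -> {for t, continuous om} ;
  rot_norm : forall t : R, `|t| < Y -> x t ^+ 2 + c t ^+ 2 = 1 ;
  rot_c_gt0 : forall t : R, `|t| < Y -> 0 < c t ;
  rot_om_gt0 : forall t : R, `|t| < Y -> 0 < om t ;
  rot_x0 : x 0 = 0 ;
  rot_x_gt0 : forall t : R, 0 < t < Y -> 0 < x t }.

Variables (Y : R) (x c om : R -> R).
Hypothesis rot : rotation Y x c om.

Lemma rot_seg y t : 0 < y < Y -> 0 <= t <= y -> `|t| < Y.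
Proof. by move=> /andP[y0 yY] /andP[t0 ty]; rewrite ger0_norm// (le_lt_trans ty). Qed.

Lemma rot_x_lt1 t : `|t| < Y -> `|x t| < 1.
Proof.
move=> tY; rewrite -(@expr_lt1 _ 2)// real_normK ?num_real//.
by rewrite -(rot_norm rot tY) ltrDl exprn_gt0// (rot_c_gt0 rot).
Qed.

Lemma rot_cx t : `|t| < Y -> {for t, continuous x}.
Proof. by move=> tY; apply: is_derive_continuous (rot_dx rot tY). Qed.

Lemma rot_cc t : `|t| < Y -> {for t, continuous c}.
Proof. by move=> tY; apply: is_derive_continuous (rot_dc rot tY). Qed.

Lemma continuous_b m : continuous (@b R m).
Proof.
move=> z; rewrite /b; apply: cvgM; first exact: cvg_cst.
exact: exprn_continuous.
Qed.

Lemma rot_cb m t : `|t| < Y -> {for t, continuous (fun t => b m (x t))}.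
Proof.
by move=> tY; apply: (continuous_comp (rot_cx tY)); exact: continuous_b.
Qed.

Lemma rot_cbom m t : `|t| < Y -> {for t, continuous (fun t => b m (x t) * om t)}.
Proof.
by move=> tY; apply: cvgM; [exact: rot_cb|exact: (rot_om rot)].
Qed.

Lemma rot_ndecr y t : 0 < y < Y -> 0 <= t <= y -> 0 <= x t <= x y.
Proof.
move=> yY /andP[t0 ty].
have mono u v : 0 <= u -> u <= v -> v <= y -> x u <= x v.
  move=> u0 uv vy; have [->//|uv'] := eqVneq u v.
  have {}uv' : u < v by rewrite lt_neqAle uv'.
  apply: (@ger0_derive1_ndecr _ x u v) => //.
  - move=> z; rewrite in_itv/= => /andP[uz zv].
    have zY : `|z| < Y by apply: (rot_seg yY); lra.
    by case: (rot_dx rot zY).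
  - move=> z; rewrite in_itv/= => /andP[uz zv].
    have zY : `|z| < Y by apply: (rot_seg yY); lra.
    have dz := rot_dx rot zY.
    rewrite derive1E derive_val mulr_ge0//.
      exact/ltW/(rot_c_gt0 rot).
    exact/ltW/(rot_om_gt0 rot).
  - apply: continuous_in_subspaceT => z; rewrite inE/= in_itv/= => /andP[uz zv].
    by apply: rot_cx; apply: (rot_seg yY); lra.
by rewrite -(rot_x0 rot) !mono.
Qed.

Local Open Scope ereal_scope.

Let I_ m y := \int[mu]_(t in `]0%R, y[) (b m (x t) * om t)%:E.

(** By [x^2 + c^2 = 1] and the ratio [bcoefS], the function [x c b_m(x) / (2m+1)] is a primitive of
    [(b_m(x) - b_{m+1}(x)) om], and it vanishes at 0. *)
Lemma integral_bS m y : (0 < y < Y)%R ->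
  I_ m y = I_ m.+1 y + (x y * c y * (b m (x y) / (2 * m + 1)%:R))%:E.
Proof.
move=> /[dup] yY /andP[y0 _].
pose F : R -> R :=
  ((bcoef R m / (2 * m + 1)%:R) *: (x ^+ (2 * m).+1 * c))%R.
pose f t : R := ((b m (x t) - b m.+1 (x t)) * om t)%R.
have cf t : (0 <= t <= y)%R -> {for t, continuous f}.
  move=> /(rot_seg yY) tY; apply: cvgM; last exact: (rot_om rot).
  by apply: cvgB; exact: rot_cb.
have dF (t : R) : (0 <= t <= y)%R -> is_derive t 1%R F (f t).
  move=> /(rot_seg yY) tY.
  have dx := rot_dx rot tY; have dc := rot_dc rot tY.
  have n1 := rot_norm rot tY.
  rewrite /F; apply: is_derive_eq.
  rewrite /f !bE !fctE /= /GRing.scale /=.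
  have p0 : (2 * m + 1)%:R != 0%R :> R by rewrite pnatr_eq0 addn1.
  have -> : bcoef R m.+1 = (bcoef R m * (2 * m + 2)%:R / (2 * m + 1)%:R)%R.
    by rewrite -bcoefS mulfK.
  rewrite mulnS add2n !exprS -[(2 * m).+1]addn1.
  have {}n1 : (c t * c t = 1 - x t * x t)%R by rewrite -n1; ring.
  (* The summand that differentiates the power carries [c t * c t]; replacing it by [1 - x t * x t]
     leaves an identity in [x t] and [om t] alone. *)
  rewrite [X in (_ * (_ + X) = _)%R]
    (_ : _ = ((2 * m + 1)%:R * x t ^+ (2 * m) * om t * (1 - x t * x t))%R).
    by rewrite !natrD; field; rewrite -!natrD addnn -mul2n.
  by rewrite -n1; ring.
rewrite /I_ -(@integral_itv_bndoo _ _ _ _ true false); last first.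
  apply/measurable_EFinP; apply: continuous_itv_measurable => t /(rot_seg yY).
  exact: rot_cbom.
rewrite -[in RHS](@integral_itv_bndoo _ _ _ _ true false); last first.
  apply/measurable_EFinP; apply: continuous_itv_measurable => t /(rot_seg yY).
  exact: rot_cbom.
have -> : (x y * c y * (b m (x y) / (2 * m + 1)%:R))%:E =
    \int[mu]_(t in `[0%R, y]) (f t)%:E.
  rewrite (@integral_itv_bndoo _ _ _ _ true false); last first.
    by apply/measurable_EFinP; exact: continuous_itv_measurable.
  rewrite (integral_derive y0 dF cf) /F !fctE (rot_x0 rot).
  rewrite expr0n/= mul0r scaler0 subr0 /GRing.scale/=.
  by congr EFin; rewrite bE exprS; ring.
rewrite -integralD//.
- by apply: eq_integral => t _; rewrite -EFinD /f; congr EFin; ring.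
- by apply: continuous_itv_integrable => t /(rot_seg yY); exact: rot_cbom.
- exact: continuous_itv_integrable.
Qed.

Lemma integral_bom_fin m y : (0 < y < Y)%R -> I_ m y \is a fin_num.
Proof.
move=> yY; rewrite /I_ -(@integral_itv_bndoo _ _ _ _ true false); last first.
  apply/measurable_EFinP; apply: continuous_itv_measurable => t /(rot_seg yY).
  exact: rot_cbom.
apply: integrable_fin_num => //.
by apply: continuous_itv_integrable => t /(rot_seg yY); exact: rot_cbom.
Qed.

Lemma rot_oo y t : (0 < y < Y)%R -> `]0%R, y[%classic t -> (`|t| < Y)%R.
Proof.
move=> yY; rewrite /= in_itv/= => /andP[/ltW t0 /ltW ty].
by apply: (rot_seg yY); rewrite t0.
Qed.

Lemma rot_bom_ge0 m y t : (0 < y < Y)%R -> `]0%R, y[%classic t ->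
  0 <= (b m (x t) * om t)%:E.
Proof.
move=> yY /(rot_oo yY) tY.
by rewrite lee_fin mulr_ge0 ?b_ge0// ltW// (rot_om_gt0 rot).
Qed.

Lemma rot_om_measurable y : (0 < y < Y)%R ->
  measurable_fun `]0%R, y[ (fun t => (om t)%:E).
Proof.
move=> yY; apply/measurable_EFinP; apply: continuous_itv_measurable => t.
by move=> /(rot_seg yY); exact: (rot_om rot).
Qed.

Lemma rot_bom_measurable m y : (0 < y < Y)%R ->
  measurable_fun `]0%R, y[ (fun t => (b m (x t) * om t)%:E).
Proof.
move=> yY; apply/measurable_EFinP; apply: continuous_itv_measurable => t.
by move=> /(rot_seg yY); exact: rot_cbom.
Qed.

(** As [x] is nondecreasing on [[0, y]], [I_ m y] is at most [b_m(x y) I_ 0 y], and [b_m(x y)] tends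
    to 0 because [x y < 1]. *)
Lemma integral_bom_cvg0 y : (0 < y < Y)%R -> I_ m y @[m --> \oo] --> 0.
Proof.
move=> yY; have /andP[y0 yY'] := yY.
have xy : (0 <= x y < 1)%R.
  rewrite ltW/= ?(rot_x_gt0 rot)//.
  by rewrite (le_lt_trans (ler_norm _))// rot_x_lt1// ger0_norm// ltW.
apply: (@squeeze_cvge _ _ _ _ (fun=> 0) _ (fun m => (b m (x y))%:E * I_ 0 y)).
- near=> m; rewrite integral_ge0/=; last by move=> t; exact: rot_bom_ge0.
  rewrite -ge0_integralZl//; last 3 first.
  + exact: rot_bom_measurable.
  + by move=> t; exact: rot_bom_ge0.
  + by rewrite lee_fin b_ge0.
  apply: ge0_le_integral => //.
  + by move=> t; exact: rot_bom_ge0.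
  + exact: rot_bom_measurable.
  + by apply: measurable_funeM; exact: rot_bom_measurable.
  + move=> t /[dup] yt; rewrite /= in_itv/= => /andP[t0 ty].
    rewrite -EFinM lee_fin mulrA ler_wpM2r//.
      by rewrite ltW// (rot_om_gt0 rot)//; exact: (rot_oo yY yt).
    have /andP[xt0 xty] : (0 <= x t <= x y)%R by apply: rot_ndecr => //; rewrite !ltW.
    by rewrite b0 mulr1 le_b// !ger0_norm// (le_trans xt0).
- exact: cvg_cst.
- rewrite -(fineK (integral_bom_fin 0 yY)) -[X in _ --> X]/(0%R%:E).
  under eq_fun do rewrite -EFinM.
  apply: cvg_EFin; first exact: nearW.
  rewrite -(mul0r (fine (I_ 0 y))); apply: cvgMl; exact: cvg_b0.
Unshelve. all: by end_near. Qed.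

(** Iterate [integral_bS] from [m] up to [M] and let [M] tend to infinity; the remainder [I_ M y]
    vanishes in the limit. *)
Lemma integral_bom m y : (0 < y < Y)%R ->
  I_ m y = (x y * c y)%:E *
    bseries (odd_div 1 (fun k => (m <= k)%N%:R)) (x y).
Proof.
move=> yY; set u := fun k => (odd_div 1 (fun k => (m <= k)%N%:R) k * b k (x y))%:E.
(* The coefficients in [u] vanish below [m], so the finite sums may start at 0. *)
have IM M : (m <= M)%N ->
    I_ m y = I_ M y + (x y * c y)%:E * \sum_(0 <= k < M) u k.
  move=> /subnK <-; elim: (M - m)%N => [|N ih].
    rewrite add0n big_nat big1 ?mule0 ?adde0// => k /andP[_ km].
    by rewrite /u /odd_div leqNgt km !mul0r.
  rewrite ih addSn big_nat_recr//= integral_bS// -addeA; congr (_ + _).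
  have -> : \sum_(0 <= k < N + m) u k = (fine (\sum_(0 <= k < N + m) u k))%:E.
    by rewrite fineK// sumEFin.
  move: (fine _) => S; rewrite [X in _ = _ * X](_ : _ =
    (S + odd_div 1 (fun k => (m <= k)%N%:R) (N + m) * b (N + m) (x y))%:E)//.
  rewrite -!EFinM -EFinD; congr EFin.
  by rewrite /odd_div leq_addl expr1 mulr1n; ring.
have : I_ M y + (x y * c y)%:E * \sum_(0 <= k < M) u k @[M --> \oo]
    --> 0 + (x y * c y)%:E * bseries (odd_div 1 (fun k => (m <= k)%N%:R)) (x y).
  apply: cvgeD; first exact: fin_num_adde_defr.
    exact: integral_bom_cvg0.
  apply: cvgeMl => //; apply: is_cvg_nneseries => k _ _.
  by apply: bseries_term_ge0; exact: odd_div_ge0.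
(* The sequence is constantly [I_ m y] from rank [m] on, so its limit is [I_ m y]. *)
rewrite add0e => cv; apply: (@cvg_unique _ _ _ _ _ _ _ cv) => //.
apply: cvg_near_cst; near=> M.
by rewrite -IM//; near: M; exists m.
Unshelve. all: by end_near. Qed.

(** Monotone convergence reduces to [integral_bom] term by term. Interchanging the resulting double
    sum over [k <= j] collects [a_0 + ... + a_j] in front of [b_j]. *)
Lemma integral_bseries_om a y : nneg a -> (0 < y < Y)%R ->
  \int[mu]_(t in `]0%R, y[) ((om t)%:E * bseries a (x t)) =
  (x y * c y)%:E * bseries (odd_div 1 (partial_sum a)) (x y).
Proof.
move=> a0 yY.
transitivity (\int[mu]_(t in `]0%R, y[)
    \sum_(k <oo) ((a k)%:E * (b k (x t) * om t)%:E)).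
  apply: eq_integral => t; rewrite inE => ty.
  rewrite /bseries -nneseriesZl; last by move=> k _; exact: bseries_term_ge0.
  by apply: eq_eseriesr => k _; rewrite -!EFinM; congr EFin; ring.
rewrite integral_nneseries//; last 2 first.
- by move=> k; apply: measurable_funeM; exact: rot_bom_measurable.
- move=> k t ty; rewrite mule_ge0// ?lee_fin//.
  by have := rot_bom_ge0 k yY ty; rewrite lee_fin.
transitivity (\sum_(k <oo) (x y * c y)%:E *
    \sum_(j <oo) ((a k * (k <= j)%N%:R)%:E * (b j (x y) / (2 * j + 1)%:R)%:E)).
  apply: eq_eseriesr => k _; rewrite ge0_integralZl//; last 3 first.
  - exact: rot_bom_measurable.
  - by move=> t; exact: rot_bom_ge0.
  - by rewrite lee_fin.
  rewrite -/(I_ k y) integral_bom// muleCA; congr (_ * _).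
  rewrite /bseries -nneseriesZl; last first.
    by move=> j _; apply: bseries_term_ge0; exact: odd_div_ge0.
  apply: eq_eseriesr => j _; rewrite -!EFinM; congr EFin.
  by rewrite /odd_div expr1; ring.
rewrite nneseriesZl; last first.
  move=> k _; apply: nneseries_ge0 => j _ _.
  have ak : (0 <= a k)%R := a0 k.
  rewrite -EFinM lee_fin; apply: mulr_ge0; first exact: mulr_ge0.
  by apply: mulr_ge0; [exact: b_ge0|rewrite invr_ge0].
congr (_ * _); rewrite nneseries_interchange; last first.
  move=> k j; have ak : (0 <= a k)%R := a0 k.
  rewrite -EFinM lee_fin; apply: mulr_ge0; first exact: mulr_ge0.
  by apply: mulr_ge0; [exact: b_ge0|rewrite invr_ge0].
apply: eq_eseriesr => j _; under eq_eseriesr do rewrite muleC.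
rewrite nneseries_partial_sum//; last first.
  by rewrite lee_fin mulr_ge0 ?b_ge0// invr_ge0.
rewrite -EFinM; congr EFin.
by rewrite /odd_div expr1; ring.
Qed.

(** Here [c om = x'], so each term [b_k(x) x'] has the primitive [x b_k(x) / (2k+1)]. *)
Lemma integral_bseries_dx a y : nneg a -> (0 < y < Y)%R ->
  \int[mu]_(t in `]0%R, y[) ((c t * om t)%:E * bseries a (x t)) =
  (x y)%:E * bseries (odd_div 1 a) (x y).
Proof.
move=> a0 yY; have /andP[y0 yY'] := yY.
have cf k (t : R) : (0 <= t <= y)%R ->
    {for t, continuous (fun t => b k (x t) * (c t * om t))%R}.
  move=> /(rot_seg yY) tY; apply: cvgM; first exact: rot_cb.
  by apply: cvgM; [exact: rot_cc|exact: (rot_om rot)].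
have f0 k t : `]0%R, y[%classic t -> (0 <= b k (x t) * (c t * om t))%R.
  move=> /(rot_oo yY) tY; apply: mulr_ge0; first exact: b_ge0.
  by apply: mulr_ge0; apply: ltW; [exact: (rot_c_gt0 rot)|exact: (rot_om_gt0 rot)].
transitivity (\int[mu]_(t in `]0%R, y[)
    \sum_(k <oo) ((a k)%:E * (b k (x t) * (c t * om t))%:E)).
  apply: eq_integral => t; rewrite inE => ty.
  rewrite /bseries -nneseriesZl; last by move=> k _; exact: bseries_term_ge0.
  by apply: eq_eseriesr => k _; rewrite -!EFinM; congr EFin; ring.
rewrite integral_nneseries//; last 2 first.
- move=> k; apply: measurable_funeM; apply/measurable_EFinP.
  exact: continuous_itv_measurable (cf k).
- by move=> k t ty; apply: mule_ge0; rewrite lee_fin; [exact: a0|exact: f0].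
rewrite /bseries -nneseriesZl; last first.
  by move=> j _; apply: bseries_term_ge0; exact: odd_div_ge0.
apply: eq_eseriesr => k _; rewrite ge0_integralZl//; last 3 first.
- by apply/measurable_EFinP; exact: continuous_itv_measurable (cf k).
- by move=> t ty; rewrite lee_fin f0.
- by rewrite lee_fin.
pose F : R -> R := ((bcoef R k / (2 * k + 1)%:R) *: (x ^+ (2 * k).+1))%R.
rewrite (integral_derive y0 (F := F) _ (cf k)).
  rewrite -!EFinM; congr EFin.
  rewrite /F !fctE (rot_x0 rot) expr0n/= scaler0 subr0 /GRing.scale/= bE exprS.
  by rewrite /odd_div expr1; ring.
move=> t /(rot_seg yY) tY; have dx := rot_dx rot tY.
rewrite /F; apply: is_derive_eq; rewrite /GRing.scale/= bE -[(2 * k).+1]addn1.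
by field; rewrite -(natrM _ 2) natr1 pnatr_eq0.
Qed.

End rotation.

(** * Words and their series *)

Section formal_sums.
Variable R : realType.
Local Notation RM := (measurableTypeR R).
Local Notation mu := (@lebesgue_measure R).
Local Open Scope ereal_scope.

Definition measurable_forms (A : formal_sum R) :=
  forall w, w \in A -> measurable_word w.

Definition abs_iterated (A : formal_sum R) (y : R) : \bar R :=
  \sum_(w <- A) abs_integral w y.

Lemma abs_iterated_ge0 A y : 0 <= abs_iterated A y.
Proof. by apply: sume_ge0 => w _; exact: abs_integral_ge0. Qed.

Lemma fcompose_nil (A : formal_sum R) : fcompose [:: [::]] A = A.
Proof. by rewrite /fcompose /= cats0 map_id. Qed.

Lemma fcompose_catl (A B C : formal_sum R) :
  fcompose (A ++ B) C = fcompose A C ++ fcompose B C.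
Proof. by rewrite /fcompose map_cat flatten_cat. Qed.

Lemma measurable_forms_compose A B :
  measurable_forms A -> measurable_forms B -> measurable_forms (fcompose A B).
Proof.
move=> mA mB w /allpairsP[[u v] /= [uA vB ->]] f; rewrite mem_cat.
by move=> /orP[]; [exact: mA|exact: mB].
Qed.

Lemma measurable_forms1 (w : word R) : measurable_word w -> measurable_forms [:: w].
Proof. by move=> mw u; rewrite inE => /eqP ->. Qed.

Lemma measurable_abs_iterated A : measurable_forms A ->
  measurable_fun setT (abs_iterated A : RM -> \bar R).
Proof.
rewrite /abs_iterated; elim: A => [_|w A ih mA].
  by under eq_fun do rewrite big_nil; exact: measurable_cst.
under eq_fun do rewrite big_cons.
apply: emeasurable_funD.
  by apply: measurable_abs_integral; apply: mA; rewrite mem_head.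
by apply: ih => u uA; apply: mA; rewrite in_cons uA orbT.
Qed.

(** [abs_integral_cons] for every word of [B], added up under the integral sign. *)
Lemma abs_iterated_cons (f : R -> R) (u : word R) B y :
  measurable_word (f :: u) -> measurable_forms B ->
  abs_iterated (fcompose [:: f :: u] B) y =
  \int[mu]_(t in seg y) (`|f t|%:E * abs_iterated (fcompose [:: u] B) t).
Proof.
move=> mfu; have [mf mu'] := measurable_word_cons mfu.
rewrite /abs_iterated /fcompose /= !cats0.
elim: B => [_|v B ih mB] /=.
  by rewrite big_nil integral0_eq// => t _; rewrite big_nil mule0.
have mB' : measurable_forms B by move=> w wB; apply: mB; rewrite in_cons wB orbT.
have mv : measurable_word v by apply: mB; rewrite mem_head.
have mcat w : measurable_word w -> measurable_word (u ++ w).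
  by move=> mw g; rewrite mem_cat => /orP[]; [exact: mu'|exact: mw].
rewrite big_cons ih// abs_integral_cons; last first.
  by move=> g; rewrite in_cons => /orP[/eqP ->//|]; exact: mcat.
have mnf : measurable_fun setT (fun t : RM => `|f t|%:E).
  by apply/measurable_EFinP; exact: measurableT_comp.
rewrite -ge0_integralD//; first last.
- apply: measurable_funTS; apply: emeasurable_funM => //.
  apply: (@measurable_abs_iterated [seq u ++ v | v <- B]).
  by move=> w /mapP[w' w'B ->]; apply: mcat; exact: mB'.
- by move=> t _; rewrite mule_ge0 ?lee_fin//; exact: abs_iterated_ge0.
- apply: measurable_funTS; apply: emeasurable_funM => //.
  by apply: measurable_abs_integral; exact: mcat.
- by move=> t _; rewrite mule_ge0 ?lee_fin// abs_integral_ge0.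
- exact: measurable_seg.
apply: eq_integral => t _; rewrite big_cons; apply/esym/ge0_muleDr.
- exact: abs_integral_ge0.
- exact: abs_iterated_ge0.
Qed.

Lemma measurable_sum_norm (fs : seq (R -> R)) : measurable_word fs ->
  measurable_fun setT (fun t : RM => (\sum_(f <- fs) `|f t|)%R).
Proof.
elim: fs => [_|f fs ih /measurable_word_cons[mf mfs]].
  by under eq_fun do rewrite big_nil; exact: measurable_cst.
under eq_fun do rewrite big_cons.
by apply: measurable_funD; [exact: measurableT_comp|exact: ih].
Qed.

(** A formal sum of 1-forms acts as one form with density the sum of the absolute values; this
    treats [H_1], which has two summands. *)
Lemma abs_iterated_letters (fs : seq (R -> R)) B y :
  measurable_word fs -> measurable_forms B ->
  abs_iterated (fcompose [seq [:: f] | f <- fs] B) y =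
  \int[mu]_(t in seg y) ((\sum_(f <- fs) `|f t|)%:E * abs_iterated B t).
Proof.
move=> + mB; elim: fs => [_|f fs ih mfs].
  rewrite /abs_iterated /= big_nil integral0_eq// => t _.
  by rewrite big_nil mul0e.
have [mf mfs'] := measurable_word_cons mfs.
rewrite map_cons -cat1s fcompose_catl /abs_iterated big_cat/=.
rewrite -!/(abs_iterated _ _) ih// abs_iterated_cons//; last first.
  by move=> g; rewrite inE => /eqP ->.
rewrite fcompose_nil -ge0_integralD//; first last.
- apply: measurable_funTS; apply: emeasurable_funM.
    by apply/measurable_EFinP; exact: measurable_sum_norm mfs'.
  exact: measurable_abs_iterated.
- by move=> t _; rewrite mule_ge0 ?lee_fin ?sumr_ge0//; exact: abs_iterated_ge0.
- apply: measurable_funTS; apply: emeasurable_funM.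
    by apply/measurable_EFinP; exact: measurableT_comp.
  exact: measurable_abs_iterated.
- by move=> t _; rewrite mule_ge0 ?lee_fin//; exact: abs_iterated_ge0.
- exact: measurable_seg.
apply: eq_integral => t _; rewrite big_cons EFinD; apply/esym/ge0_muleDl.
- by rewrite lee_fin.
- by rewrite lee_fin sumr_ge0.
Qed.

End formal_sums.

(** * Effect of the letters on coefficient sequences *)

Section rotation_forms.
Variable R : realType.
Local Notation RM := (measurableTypeR R).
Local Notation mu := (@lebesgue_measure R).
Local Open Scope ereal_scope.

(* The coefficient of [b_k] in the nested sum, see [nested_sumE]. *)
Definition coef (n : nat) (s : seq nat) : nat -> R :=
  foldr (fun si a => odd_div si (partial_sum a)) (fun k => (k == n)%:R)%R s.

Lemma coef_ge0 n s : nneg (coef n s).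
Proof.
elim: s => [k|si s ih] /=; first exact: ler0n.
exact/odd_div_ge0/partial_sum_ge0.
Qed.

Lemma bseries_coef0 n (z : R) : bseries (coef n [::]) z = (b n z)%:E.
Proof.
rewrite /bseries (@nneseriesD1 _ _ n)//=; last first.
  by move=> k _; rewrite lee_fin; apply: mulr_ge0; [exact: ler0n|exact: b_ge0].
rewrite eqxx mul1r eseries0 ?adde0// => k _ /negbTE kn.
by rewrite kn mul0r.
Qed.

(* [h s] and [H s] with their 1-forms abstracted; [fs] lists the summands of the
   1-form for s = 1. *)
Definition letter (fs : seq (R -> R)) (f3 f0 : R -> R) (s : nat) : formal_sum R :=
  if s == 1%N then [seq [:: f] | f <- fs]
  else [:: f3 :: nseq (s - 2) f0 ++ [:: f3]].

Definition letters fs f3 f0 g (s : seq nat) : formal_sum R :=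
  foldr (fun si => fcompose (letter fs f3 f0 si)) (single g) s.

Variables (Y : R) (x c om : R -> R).
Hypothesis rot : rotation Y x c om.
Variables (fs : seq (R -> R)) (f3 f0 g : R -> R) (n : nat).
Hypotheses (mfs : measurable_word fs)
  (mf3 : measurable_fun setT (f3 : RM -> RM))
  (mf0 : measurable_fun setT (f0 : RM -> RM))
  (mg : measurable_fun setT (g : RM -> RM)).
Hypothesis fsE : forall t, (0 < t < Y)%R ->
  (\sum_(f <- fs) `|f t| = om t / (x t * c t))%R.
Hypothesis f3E : forall t, (0 < t < Y)%R -> (`|f3 t| = om t / x t)%R.
Hypothesis f0E : forall t, (0 < t < Y)%R -> (`|f0 t| = c t * om t / x t)%R.
Hypothesis gE : forall t, (0 < t < Y)%R -> (`|g t| = b n (x t) * om t)%R.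

Let J := @abs_iterated R.

Lemma measurable_letter_word k : measurable_word (nseq k f0 ++ [:: f3]).
Proof.
move=> f; rewrite mem_cat mem_nseq inE => /orP[/andP[_ /eqP ->]|/eqP ->] //.
Qed.

Lemma measurable_letter s : measurable_forms (letter fs f3 f0 s).
Proof.
rewrite /letter; case: ifP => _.
  by move=> w /mapP[f ffs ->] f'; rewrite inE => /eqP ->; exact: mfs.
apply: measurable_forms1 => f; rewrite in_cons => /orP[/eqP ->//|].
exact: measurable_letter_word.
Qed.

Lemma measurable_letters s : measurable_forms (letters fs f3 f0 g s).
Proof.
elim: s => [|si s ih]; last first.
  by apply: measurable_forms_compose => //; exact: measurable_letter.
by apply: measurable_forms1 => f; rewrite inE => /eqP ->.
Qed.

Lemma rot_pos t : (0 < t < Y)%R -> [/\ (x t != 0), (c t != 0) & (0 <= x t)]%R.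
Proof.
move=> tY; have /andP[t0 tY'] := tY; split.
- by rewrite gt_eqF// (rot_x_gt0 rot).
- by rewrite gt_eqF// (rot_c_gt0 rot)// ger0_norm// ltW.
- by rewrite ltW// (rot_x_gt0 rot).
Qed.

Lemma integral_seg_eq y (u v : R -> \bar R) : (0 < y < Y)%R ->
  (forall t, (0 < t < Y)%R -> u t = v t) ->
  \int[mu]_(t in seg y) u t = \int[mu]_(t in `]0%R, y[) v t.
Proof.
move=> /andP[y0 yY] uv; rewrite segE ?ltW//; apply: eq_integral => t.
rewrite inE/= in_itv/= => /andP[t0 ty]; apply: uv.
by rewrite t0 (lt_trans ty).
Qed.

(** The last form [om / x] cancels the [x] of [x c], leaving [c om]; each further form [c om / x]
    cancels the [x] produced by the previous integration. Each of the [k+1] integrations thus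
    divides the coefficients once by [2k+1], taken at the index of the series. *)
Lemma abs_iterated_tail k (B : formal_sum R) a y :
  measurable_forms B -> nneg a ->
  (forall t, (0 < t < Y)%R -> J B t = (x t * c t)%:E * bseries a (x t)) ->
  (0 < y < Y)%R ->
  J (fcompose [:: nseq k f0 ++ [:: f3]] B) y =
  (x y)%:E * bseries (odd_div k.+1 a) (x y).
Proof.
move=> mB a0 JB; elim: k y => [|k ih] y yY /=.
  rewrite /J abs_iterated_cons//; last by move=> f; rewrite inE => /eqP ->.
  rewrite fcompose_nil -(integral_bseries_dx rot)//.
  apply: integral_seg_eq => // t tY; have [x0 c0 _] := rot_pos tY.
  rewrite -/(J _ _) JB// muleA f3E// -EFinM; congr (_%:E * _).
  by field; rewrite x0.
rewrite /J abs_iterated_cons//; last first.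
  by move=> f; rewrite in_cons => /orP[/eqP ->//|]; exact: measurable_letter_word.
rewrite -addn1 -odd_divD -(integral_bseries_dx rot)//; last exact: odd_div_ge0.
apply: integral_seg_eq => // t tY; have [x0 c0 _] := rot_pos tY.
rewrite -/(J _ _) ih// muleA f0E// -EFinM; congr (_%:E * _).
by field; rewrite x0.
Qed.

(** The outermost integral is left unevaluated, so that the derivative in [y] can be read off from
    the integrand. *)
Lemma abs_iterated_letters_om s y : all (leq 1) s -> (0 < y < Y)%R ->
  J (letters fs f3 f0 g s) y =
  \int[mu]_(t in `]0%R, y[) ((om t)%:E * bseries (coef n s) (x t)).
Proof.
elim: s y => [|si s ih] y /= => [_|/andP[si0 s0]] yY.
  rewrite /J /abs_iterated /= big_seq1 abs_integral_cons; last first.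
    by move=> f; rewrite inE => /eqP ->.
  apply: integral_seg_eq => // t /[dup] tY /andP[t0 _].
  by rewrite abs_integral_nil ?gt_eqF// mule1 gE// bseries_coef0 mulrC.
have mB := @measurable_letters s.
have a0 := @coef_ge0 n s.
set a := odd_div 1 (partial_sum (coef n s)).
have a0' : nneg a by exact/odd_div_ge0/partial_sum_ge0.
(* Evaluating the outermost integral of the shorter word gives the factor [x c] and one division by
   [2k+1]. *)
have JB t : (0 < t < Y)%R ->
    J (letters fs f3 f0 g s) t = (x t * c t)%:E * bseries a (x t).
  by move=> tY; rewrite ih// (integral_bseries_om rot).
(* One of the [si] divisions is already contained in [a]; this uses [si >= 1]. *)
have -> : odd_div si (partial_sum (coef n s)) = odd_div si.-1 a.
  by rewrite /a odd_divD add1n prednK.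
rewrite {1}/letter; case: ifPn => [/eqP ->|si1].
  rewrite /J abs_iterated_letters// odd_div0.
  apply: integral_seg_eq => // t tY; have [x0 c0 _] := rot_pos tY.
  rewrite -/(J _ _) JB// muleA fsE// -EFinM; congr (_%:E * _).
  by field; rewrite x0 c0.
rewrite /J abs_iterated_cons//; last first.
  by move=> f; rewrite in_cons => /orP[/eqP ->//|]; exact: measurable_letter_word.
apply: integral_seg_eq => // t tY; have [x0 c0 _] := rot_pos tY.
rewrite -/(J _ _) (@abs_iterated_tail _ _ a)//.
(* The leading form cancels the factor [x] of the tail, and the tail itself accounts for [si - 1]
   divisions, as [si >= 2] here. *)
rewrite muleA f3E// -EFinM (_ : (si - 2).+1 = si.-1); last by lia.
by congr (_%:E * _); field; rewrite x0.
Qed.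

End rotation_forms.

(** * Nested sums as series *)

Section nested_sums.
Variable R : realType.
Local Open Scope ereal_scope.

Definition descending (d n : nat) : set (d.-tuple nat) :=
  [set k | sorted geq (rcons k n)].

Definition odd_prod d (s k : d.-tuple nat) : R :=
  (\prod_(i < d) (2 * tnth k i + 1)%:R ^+ tnth s i)%R.

Lemma odd_prod_gt0 d (s k : d.-tuple nat) : (0 < odd_prod s k)%R.
Proof. by apply: prodr_gt0 => i _; rewrite exprn_gt0// ltr0n addn1. Qed.

Lemma odd_prod_cons d s1 k1 (s k : d.-tuple nat) :
  odd_prod [tuple of s1 :: s] [tuple of k1 :: k] =
  ((2 * k1 + 1)%:R ^+ s1 * odd_prod s k)%R.
Proof.
rewrite /odd_prod big_ord_recl !tnth0; congr (_ * _)%R.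
by apply: eq_bigr => i _; rewrite !tnthS.
Qed.

Lemma descending_cons d n k1 (k : d.-tuple nat) :
  descending n [tuple of k1 :: k] <-> descending n k /\ (head n k <= k1)%N.
Proof.
rewrite /descending /=; case: k => -[|a l] _ /=.
  by rewrite andbT; split => [|[]].
by split => [/andP[]|[? ?]] //; apply/andP.
Qed.

(** Reindexing by tail and first entry: [head n k] is the largest entry of the tail, or [n] if the
    tail is empty. *)
Lemma esum_descending d n (F : d.+1.-tuple nat -> \bar R) :
  (forall k, 0 <= F k) ->
  \esum_(k in descending n) F k =
  \esum_(k in @descending d n) \sum_(k1 <oo | (head n k <= k1)%N)
     F [tuple of k1 :: k].
Proof.
move=> F0.
under [RHS]eq_esum do rewrite nneseries_esum//.
rewrite (@esum_esum _ _ _ _ (fun k : d.-tuple nat => [set k1 | (head n k <= k1)%N])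
  (fun k k1 => F [tuple of k1 :: k]))//.
apply: (reindex_esum _ _ (fun z : d.-tuple nat * nat => [tuple of z.2 :: z.1])).
split.
- by move=> [k k1] /= [? ?]; apply/descending_cons.
- move=> [k k1] [l l1] /= _ _ /(congr1 val)/= [-> kl]; congr pair.
  exact: val_inj.
- move=> k dk; exists ([tuple of behead k], thead k) => /=; last first.
    by rewrite [RHS](tuple_eta k).
  by move: dk; rewrite {1}(tuple_eta k) => /descending_cons.
Qed.

(** The weight [phi] is arbitrary so that the induction goes through: summing over the outermost
    index turns it into another weight on the next index. *)
Lemma esum_coef d n (s : d.-tuple nat) (phi : nat -> \bar R) :
  (forall k, 0 <= phi k) ->
  \esum_(k in descending n) (phi (head n k) * (odd_prod s k)^-1%:E) =
  \sum_(k <oo) ((coef R n s k)%:E * phi k).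
Proof.
elim: d s phi => [|d ih] s phi phi0.
  rewrite (_ : descending n = [set [tuple]]); last first.
    by apply/seteqP; split => t // _; rewrite /= (tuple0 t).
  rewrite esum_set1; last by rewrite mule_ge0// lee_fin invr_ge0 ltW// odd_prod_gt0.
  rewrite /odd_prod big_ord0 invr1 mule1 (tuple0 s) (@nneseriesD1 _ _ n)//=.
    by rewrite eqxx mul1e eseries0 ?adde0// => k _ /negbTE ->; rewrite mul0e.
  by move=> k _; rewrite mule_ge0// lee_fin.
have inv0 k s1 : 0 <= ((2 * k + 1)%:R ^+ s1)^-1%:E :> \bar R.
  by rewrite lee_fin invr_ge0 exprn_ge0.
rewrite esum_descending; last first.
  by move=> k; rewrite mule_ge0// lee_fin invr_ge0 ltW// odd_prod_gt0.
pose s1 := thead s; pose s' := [tuple of behead s].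
have -> : s = [tuple of s1 :: s'] by exact: tuple_eta.
pose psi m := \sum_(k <oo | (m <= k)%N) (phi k * ((2 * k + 1)%:R ^+ s1)^-1%:E).
transitivity (\esum_(k in @descending d n) (psi (head n k) * (odd_prod s' k)^-1%:E)).
  apply: eq_esum => k _; rewrite /psi muleC -nneseriesZl; last first.
    by move=> j _; rewrite mule_ge0.
  apply: eq_eseriesr => j _; rewrite odd_prod_cons invfM EFinM /=.
  by rewrite muleA muleC.
rewrite ih; last by move=> m; apply: nneseries_ge0 => k _ _; rewrite mule_ge0.
have a0 := @coef_ge0 R n s'.
(* Writing the range [m <= k] as an indicator lets the two sums be interchanged; the sum over [m]
   then becomes a partial sum of coefficients. *)
transitivity (\sum_(m <oo) \sum_(k <oo)
    ((phi k * ((2 * k + 1)%:R ^+ s1)^-1%:E) * (coef R n s' m * (m <= k)%N%:R)%:E)).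
  apply: eq_eseriesr => m _; rewrite /psi -nneseriesZl; last first.
    by move=> k _; rewrite mule_ge0.
  rewrite eseries_mkcond; apply: eq_eseriesr => k _.
  by case: ifPn => _; rewrite ?mulr1 ?mulr0 ?mule0// muleC.
rewrite nneseries_interchange; last first.
  by move=> m k; rewrite mule_ge0// ?mule_ge0// lee_fin mulr_ge0//; exact: a0.
apply: eq_eseriesr => k _ /=.
rewrite nneseries_partial_sum//; last by rewrite mule_ge0.
rewrite -muleA -EFinM muleC; congr (_%:E * _).
by rewrite /odd_div mulrC.
Qed.

Lemma nested_sumE d (s : d.-tuple nat) n (z : R) :
  nested_sum s n z = bseries (coef R n s) z.
Proof.
rewrite /nested_sum -/(descending n).
under eq_esum do rewrite EFinM.
rewrite (@esum_coef _ n s (fun k => (b k z)%:E)); last first.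
  by move=> k; rewrite lee_fin b_ge0.
by apply: eq_eseriesr => k _; rewrite EFinM.
Qed.

End nested_sums.

(** * Convergence and continuity *)

Section convergence.
Variable R : realType.
Local Notation mu := (@lebesgue_measure R).

Lemma rotation_asin : rotation 1 (@id R) (fun t => Num.sqrt (1 - t ^+ 2)) (@omega1 R).
Proof.
have p0 (t : R) : `|t| < 1 -> 0 < 1 - t ^+ 2.
  move=> t1; rewrite subr_gt0 -real_normK ?num_real//.
  by rewrite expr_lt1.
have s0 (t : R) : `|t| < 1 -> 0 < Num.sqrt (1 - t ^+ 2).
  by move=> /p0; rewrite sqrtr_gt0.
split => //.
- move=> t t1; apply: is_derive_eq.
  by rewrite /omega1 mulfV// gt_eqF// s0.
- move=> t t1.
  have ds := is_derive1_sqrt (p0 _ t1).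
  have dq : is_derive t 1 (fun t : R => 1 - t ^+ 2) (- (2 * t)).
    rewrite (_ : (fun t => _) = cst 1 - (@id R) ^+ 2)//.
    by apply: is_derive_eq; rewrite /GRing.scale/= !mulr1 expr1 sub0r mulr_natl.
  have := @is_derive1_comp _ _ (fun t : R => 1 - t ^+ 2) t _ _ ds dq.
  move=> h; apply: is_derive_eq h _; rewrite /omega1 /GRing.scale/=.
  by field; rewrite gt_eqF ?s0.
- move=> t t1; rewrite /omega1; apply: cvgV; first by rewrite gt_eqF ?s0.
  apply: (@continuous_comp _ _ _ (fun t : R => 1 - t ^+ 2) Num.sqrt).
    by apply: cvgB; [exact: cvg_cst|exact: exprn_continuous].
  exact: sqrt_continuous.
- by move=> t t1; rewrite sqr_sqrtr ?ltW ?p0// addrC subrK.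
- by move=> t t1; rewrite /omega1 invr_gt0 s0.
- by move=> t /andP[].
Qed.

Lemma rotation_trig : rotation (pi / 2) (@sin R) (@cos R) (fun=> 1).
Proof.
split => //.
- by move=> t _; rewrite mulr1; exact: is_derive_sin.
- by move=> t _; rewrite mulr1; exact: is_derive_cos.
- by move=> t _; exact: cvg_cst.
- by move=> t _; rewrite addrC cos2Dsin2.
- by move=> t; rewrite ltr_norml; exact: cos_gt0_pihalf.
- exact: sin0.
- exact: sin_gt0_pihalf.
Qed.

Local Open Scope ereal_scope.

Definition bsummable (a : nat -> R) := forall z, (`|z| < 1)%R -> bseries a z < +oo.

(* The series of [partial_sum a] is an integral of the series of [a] over a compact
   interval, on which the latter is bounded by monotonicity. *)
Lemma bsummable_partial_sum a : nneg a -> bsummable a ->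
  bsummable (odd_div 1 (partial_sum a)).
Proof.
(* A point strictly between the absolute value of [z] and 1: the series at [z] is bounded by the
   series at [y], which [integral_bseries_om] controls. *)
move=> a0 sa z z1; pose y : R := ((1 + `|z|) / 2)%R.
have yz : (`|z| < y)%R by rewrite /y; lra.
have y0 : (0 < y < 1)%R by rewrite (le_lt_trans _ yz)//= /y; lra.
have a0' : nneg (odd_div 1 (partial_sum a)) by exact/odd_div_ge0/partial_sum_ge0.
have zy : (`|z| <= `|y|)%R by rewrite (le_trans (ltW yz))// ler_norm.
apply: le_lt_trans (le_bseries a0' zy) _.
have := integral_bseries_om rotation_asin a0 y0; set S := bseries _ _ => e.
have y1 : (`|y| < 1)%R by case/andP: y0 => ? ?; rewrite ger0_norm// ltW.
have cy : (0 < Num.sqrt (1 - y ^+ 2))%R := rot_c_gt0 rotation_asin y1.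
have fin0 := integral_bom_fin rotation_asin 0 y0.
have le : \int[mu]_(t in `]0%R, y[) ((omega1 t)%:E * bseries a t) <=
    bseries a y * \int[mu]_(t in `]0%R, y[) (b 0 t * omega1 t)%:E.
  rewrite -ge0_integralZl//; last 3 first.
  - exact: (rot_bom_measurable rotation_asin).
  - by move=> t; exact: (rot_bom_ge0 rotation_asin).
  - exact: bseries_ge0.
  apply: ge0_le_integral => //.
  - move=> t yt; rewrite mule_ge0 ?bseries_ge0// lee_fin ltW//.
    exact/(rot_om_gt0 rotation_asin)/(rot_oo y0 yt).
  - apply: emeasurable_funM; last exact: measurable_bseries.
    exact: (rot_om_measurable rotation_asin).
  - by apply: emeasurable_funM => //; exact: (rot_bom_measurable rotation_asin).
  - move=> t /[dup] yt; rewrite /= in_itv/= => /andP[t0 ty].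
    rewrite b0 mul1r muleC lee_wpmul2r ?le_bseries//.
      by rewrite lee_fin ltW//; exact/(rot_om_gt0 rotation_asin)/(rot_oo y0 yt).
    by rewrite !ger0_norm ?ltW// (lt_trans t0).
have : (y * Num.sqrt (1 - y ^+ 2))%:E * S < +oo.
  rewrite -e (le_lt_trans le)//.
  rewrite lte_mul_pinfty ?bseries_ge0//.
    by rewrite ge0_fin_numE ?bseries_ge0// sa.
  by rewrite ltey_eq fin0.
have yc : (0 < y * Num.sqrt (1 - y ^+ 2))%R by case/andP: y0 => ? _; rewrite mulr_gt0.
have S0 : 0 <= S := bseries_ge0 _ a0'.
(* An infinite [S] would make its product with a positive factor infinite. *)
case: S S0 {e} => [r _ _|_|]//; first exact: ltry.
by rewrite gt0_muley// lte_fin.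
Qed.

(** For [si >= 1], dividing by [(2k+1)^si] gives at most what dividing by [2k+1] gives, so
    [bsummable_partial_sum] dominates each step. *)
Lemma bsummable_coef n s : all (leq 1) s -> bsummable (coef R n s).
Proof.
elim: s => [_ z _|si s ih /= /andP[si0 s0]].
  by rewrite bseries_coef0 ltry.
have sa := bsummable_partial_sum (@coef_ge0 R n s) (ih s0).
move=> z z1; apply: le_lt_trans (sa z z1).
apply: lee_nneseries => k *.
  exact/bseries_term_ge0/odd_div_ge0/partial_sum_ge0/coef_ge0.
rewrite lee_fin ler_wpM2r ?b_ge0// /odd_div ler_wpM2l//.
  exact/partial_sum_ge0/coef_ge0.
rewrite lef_pV2 ?posrE ?exprn_gt0 ?ltr0n ?addn1//.
by apply: ler_weXn2l; rewrite ?ler1n.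
Qed.

Lemma bsummable_fin a z : nneg a -> bsummable a -> (`|z| < 1)%R ->
  bseries a z \is a fin_num.
Proof. by move=> a0 sa z1; rewrite ge0_fin_numE ?bseries_ge0// sa. Qed.

(** Uniform approximation by polynomials on a closed disc of radius [r < 1]: nonnegative
    coefficients make every tail there at most the tail at [r], and an [e / 3] argument
    concludes. *)
Lemma continuous_bseries a z : nneg a -> bsummable a -> (`|z| < 1)%R ->
  {for z, continuous (fun z => fine (bseries a z))}.
Proof.
move=> a0 sa z1; pose r : R := ((1 + `|z|) / 2)%R.
have zr : (`|z| < r)%R by rewrite /r; lra.
have r0 : (0 <= r)%R by rewrite (le_trans _ (ltW zr)).
have r1 : (`|r| < 1)%R by rewrite ger0_norm// /r; lra.
have term0 u k : 0 <= (a k * b k u)%:E by exact: bseries_term_ge0.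
pose P N u := (\sum_(0 <= k < N) a k * b k u)%R.
pose T N u := \sum_(N <= k <oo) (a k * b k u)%:E.
have split N u : bseries a u = (P N u)%:E + T N u.
  by rewrite /bseries (nneseries_split 0 N)// add0n sumEFin.
have T0 N u : 0 <= T N u by apply: nneseries_ge0.
have Tle N u : (`|u| <= r)%R -> T N u <= T N r.
  move=> ur; apply: lee_nneseries => k *; first exact: term0.
  by rewrite lee_fin ler_wpM2l// ?le_b ?(ger0_norm r0)//; exact: a0.
apply/cvgrPdist_lt => /= e e0.
have := nneseries_tail_cvg (sa r r1) (fun k _ => term0 r k).
move=> /fine_cvgP[_ /cvgrPdist_lt /(_ (e / 3)%R)].
rewrite divr_gt0// => /(_ isT)[N _ /(_ N (leqnn N))/=].
rewrite sub0r normrN -/(T N r) => TN.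
have Tfin u : (`|u| <= r)%R -> T N u = (fine (T N u))%:E.
  move=> ur; rewrite fineK//; have /(bsummable_fin a0 sa) : (`|u| < 1)%R.
    by rewrite (le_lt_trans ur)// -(ger0_norm r0).
  by rewrite (split N) fin_numD => /andP[].
have Tsmall u : (`|u| <= r)%R -> (0 <= fine (T N u) < e / 3)%R.
  move=> ur; rewrite fine_ge0//=; apply: le_lt_trans (lt_le_trans TN (lexx _)).
  by rewrite (le_trans _ (ler_norm _))// -lee_fin -!Tfin// ?Tle// ger0_norm.
have fE u : (`|u| <= r)%R -> fine (bseries a u) = (P N u + fine (T N u))%R.
  by move=> ur; rewrite (split N) Tfin.
have cP : {for z, continuous (P N)}.
  elim: {TN Tfin Tsmall fE} N => [|N ih].
    rewrite (_ : P 0%N = cst 0%R); first exact: cvg_cst.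
    by apply/funext => u; rewrite /P big_nil.
  rewrite (_ : P N.+1 = (fun u => P N u + a N * b N u)%R).
    apply: cvgD; first exact: ih.
    by apply: cvgM; [exact: cvg_cst|exact: continuous_b].
  by apply/funext => u; rewrite /P big_nat_recr.
have e3 : (0 < e / 3)%R by rewrite divr_gt0.
have {}cP := proj1 (cvgrPdist_lt _ _) cP (e / 3)%R e3.
near=> u.
have ur : (`|u| <= r)%R.
  by near: u; exact: (@cvgr_norm_le _ _ _ _ _ id z cvg_id).
rewrite !fE// ?ltW//.
have /andP[? ?] := Tsmall u ur.
have /andP[? ?] := Tsmall z (ltW zr).
have : (`|P N z - P N u| < e / 3)%R by near: u; exact: cP.
rewrite !ltr_norml => /andP[? ?]; apply/andP; split; lra.
Unshelve. all: by end_near. Qed.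

End convergence.

(** * Odd primitives *)

Section odd_primitive.
Variable R : realType.
Local Notation mu := (@lebesgue_measure R).

(** Oddness of [F] and evenness of [G] extend the integral formula to negative arguments, so near
    [y] the function [F] is a primitive of [G] up to a constant. *)
Lemma derive_odd_primitive (Y : R) (G F : R -> R) :
  (forall t, `|t| < Y -> {for t, continuous G}) ->
  (forall t, `|t| < Y -> G (- t) = G t) ->
  (forall y, 0 < y < Y -> F y = \int[mu]_(t in `]0, y[) G t) ->
  (forall y, `|y| < Y -> F (- y) = - F y) ->
  forall y : R, `|y| < Y -> is_derive y 1 F (G y).
Proof.
move=> cG eG FE oF y yY; pose r : R := (`|y| + Y) / 2.
have yr : `|y| < r by rewrite /r; lra.
have rY : r < Y by rewrite /r; lra.
have r0 : 0 < r by rewrite (le_lt_trans _ yr).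
have nr0 : - r < 0 by lra.
have cGab a c : - r <= a -> c <= r -> {within `[a, c], continuous G}.
  move=> ar cr; apply: continuous_in_subspaceT => t.
  rewrite inE/= in_itv/= => /andP[at_ tc].
  by apply: cG; rewrite ltr_norml; apply/andP; split; lra.
have iG a c : - r <= a -> c <= r -> mu.-integrable `[a, c] (EFin \o G).
  move=> ar cr; apply: continuous_compact_integrable; first exact: segment_compact.
  exact: cGab.
(* A base point to the left of both 0 and [y] lets one application of the fundamental theorem cover
   every sign of [y]. *)
pose P z := \int[mu]_(t in `[(- r), z]) G t.
have PE z : `|z| < r -> F z = P z - P 0.
  move=> zr; have zY : `|z| < Y by exact: lt_trans rY.
  have [nr zr'] : - r < z /\ z < r by apply/andP; rewrite -ltr_norml.
  have [z0|z0|z0] := ltgtP z 0.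
  - rewrite -[P z - _]opprB /P Rintegral_itvB ?bnd_simp ?ltW//; last first.
      by apply: iG => //; exact: ltW.
    rewrite Rintegral_itv_obnd_cbnd; last first.
      apply: (@integrableS _ _ _ mu `[z, 0]%classic) => //.
        by apply: subset_itv; rewrite bnd_simp.
      by apply: iG; exact: ltW.
    have e : (\int[mu]_(t in `[z, 0%R]) (G t)%:E =
              \int[mu]_(t in `[0%R, (- z)%R]) (G t)%:E)%E.
      have := @integration_by_substitution_oppr _ G 0 (- z).
      rewrite opprK oppr0 => -> //; last 2 first.
      + by rewrite oppr_ge0 ltW.
      + by apply: cGab; lra.
      apply: eq_integral => t; rewrite inE/= in_itv/= => /andP[t0 tz].
      by rewrite eG// ger0_norm//; lra.
    rewrite /Rintegral e -/(Rintegral _ _ _).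
    rewrite -Rintegral_itv_bndo_bndc; last first.
      apply: (@integrableS _ _ _ mu `[0, (- z)]%classic) => //.
        by apply: subset_itv; rewrite bnd_simp.
      by apply: iG; lra.
    rewrite -Rintegral_itv_obnd_cbnd; last first.
      apply: (@integrableS _ _ _ mu `[0, (- z)]%classic) => //.
        by apply: subset_itv; rewrite bnd_simp.
      by apply: iG; lra.
    by rewrite -FE ?oF ?opprK//; apply/andP; split; lra.
  - rewrite /P Rintegral_itvB ?bnd_simp ?ltW//; last first.
      by apply: iG => //; exact: ltW.
    rewrite FE ?z0 ?(lt_trans zr')// Rintegral_itv_bndo_bndc//.
    apply: (@integrableS _ _ _ mu `[0, z]%classic) => //.
      by apply: subset_itv; rewrite bnd_simp.
    by apply: iG => //; [lra|exact: ltW].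
  - rewrite z0 subrr; have := oF 0; rewrite oppr0 normr0 => /(_ (lt_trans r0 rY)).
    by move=> F0; lra.
have [dP P'] : derivable P y 1 /\ derive1 P y = G y.
  have [yr1 yr2] : - r < y /\ y < r by apply/andP; rewrite -ltr_norml.
  apply: (@continuous_FTC1_closed _ G (- r) y r) => //; last exact: cG.
  exact: iG.
apply: (@near_eq_is_derive _ _ _ (P - cst (P 0))).
  near=> z; rewrite fctE PE//.
  by near: z; apply: (@cvgr_norm_lt _ _ _ _ _ id y cvg_id).
have dP' : is_derive y 1 P (G y) by apply: DeriveDef => //; rewrite -derive1E.
by apply: is_derive_eq; rewrite subr0.
Unshelve. all: by end_near. Qed.

End odd_primitive.

(** * Parity and the derivative *)

Section signs.
Variable R : realType.
Local Notation RM := (measurableTypeR R).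
Local Notation mu := (@lebesgue_measure R).
Variable Y : R.

Definition nneg_right (f : R -> R) := forall t, 0 < t < Y -> 0 <= f t.
Definition odd_nneg (f : R -> R) := (forall t, f (- t) = - f t) /\ nneg_right f.
Definition even_nneg (f : R -> R) := (forall t, f (- t) = f t) /\ nneg_right f.

Lemma tuple_cons_ind p (Q : p.+1.-tuple RM -> Prop) :
  (forall x t, Q (cons_pair (x, t))) -> forall t, Q t.
Proof.
by move=> Qc t; rewrite (tuple_eta t); exact: (Qc (thead t) (behead_tuple t)).
Qed.

Lemma word_integrand_ge0 (w : word R) y (t : (size w).-tuple RM) :
  (forall f, f \in w -> nneg_right f) -> 0 <= y < Y -> simplex y t ->
  0 <= word_integrand t.
Proof.
elim: w y t => [|f w ih] y t fw yY.
  by rewrite (tuple0 t) /word_integrand big_nil.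
move: t; apply: tuple_cons_ind => x t /simplex_cons[].
have /andP[y0 yY'] := yY.
rewrite segE//= in_itv/= => /andP[x0 xy] xt.
rewrite word_integrand_cons mulr_ge0//.
  by apply: fw; rewrite ?mem_head// x0 (lt_trans xy).
apply: ih xt; last by rewrite (ltW x0) (lt_trans xy).
by move=> h hw; apply: fw; rewrite in_cons hw orbT.
Qed.

(** At negative arguments each odd form contributes one sign and the final even form none. *)
Lemma word_integrand_sign (w : word R) g y (t : (size (rcons w g)).-tuple RM) :
  (forall f, f \in w -> odd_nneg f) -> even_nneg g -> 0 < y < Y ->
  simplex (- y) t -> 0 <= (-1) ^+ size w * word_integrand t.
Proof.
move=> + [gN g0]; elim: w y t => [|f w ih] y t fw yY.
  move: t; apply: tuple_cons_ind => x t /simplex_cons[/segN/segP xy _].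
  rewrite word_integrand_cons (tuple0 t) /word_integrand big_nil expr0 mul1r mulr1.
  by rewrite -gN; apply: g0; case: xy yY => -[? ?] /andP[? ?]; apply/andP; split; lra.
move: t; apply: tuple_cons_ind => x t /simplex_cons[/segN/segP xy xt].
have [fN f0] := fw f (mem_head _ _).
have xy' : 0 < - x < Y.
  by case: xy yY => -[? ?] /andP[? ?]; apply/andP; split; lra.
rewrite word_integrand_cons exprS mulN1r mulNr mulrCA -mulNr -fN mulr_ge0//.
  exact: f0.
apply: (ih (- x)) => //; last by rewrite opprK.
by move=> h hw; apply: fw; rewrite in_cons hw orbT.
Qed.

Lemma word_integral_pos w y : (forall f, f \in w -> nneg_right f) ->
  0 < y < Y -> word_integral w y = fine (abs_integral w y).
Proof.
move=> fw /andP[y0 yY]; rewrite /word_integral ltW// mul1r /Rintegral.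
congr fine; apply: eq_integral => t /set_mem yt; rewrite ger0_norm//.
by apply: (word_integrand_ge0 fw _ yt); rewrite ltW.
Qed.

(** The orientation contributes [size w + 1] signs and the integrand [size w], which leaves exactly
    one. *)
Lemma word_integral_neg w g y :
  (forall f, f \in w -> odd_nneg f) -> even_nneg g -> 0 < y < Y ->
  word_integral (rcons w g) (- y) = - fine (abs_integral (rcons w g) (- y)).
Proof.
move=> fw eg yY; have /andP[y0 _] := yY.
rewrite /word_integral leNgt oppr_lt0 y0/= /Rintegral /abs_integral.
have nE t : simplex (- y) t ->
    @word_integrand R (rcons w g) t =
    (-1) ^+ size w * `|@word_integrand R (rcons w g) t|.
  move=> yt; have := word_integrand_sign fw eg yY yt.
  rewrite -signr_odd; case: (odd _) => /=.
    by rewrite expr1 !mulN1r oppr_ge0 => h; rewrite ler0_norm// opprK.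
  by rewrite expr0 !mul1r => h; rewrite ger0_norm.
have -> : (\int[lebesgue_tuple R (size (rcons w g))]_(t in simplex (- y))
      (word_integrand t)%:E =
    ((-1) ^+ size w)%:E *
    \int[lebesgue_tuple R (size (rcons w g))]_(t in simplex (- y))
      `|word_integrand t|%:E)%E.
  transitivity (\int[lebesgue_tuple R (size (rcons w g))]_(t in simplex (- y))
      (((-1) ^+ size w)%:E * `|@word_integrand R (rcons w g) t|%:E))%E.
    by apply: eq_integral => t /set_mem yt; rewrite [in LHS]nE// EFinM.
  rewrite -signr_odd; case: (odd _) => /=.
    rewrite expr1 mulN1e -integral_ge0N//.
    by apply: eq_integral => t _; rewrite mulN1e.
  by rewrite expr0 mul1e; apply: eq_integral => t _; rewrite mul1e.
have -> : (-1) ^+ size (rcons w g) = -1 * (-1) ^+ size w :> R.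
  by rewrite size_rcons exprS.
(* Since [fine] sends both infinities to 0, it commutes with a sign at infinite values too, and no
   finiteness is required. *)
have -> : forall z : \bar R,
    fine (((-1) ^+ size w)%:E * z)%E = (-1) ^+ size w * fine z.
  move=> z; rewrite -signr_odd; case: (odd _) => /=.
    by rewrite expr1 !mulN1e mulN1r; case: z => //=; rewrite oppr0.
  by rewrite expr0 mul1e mul1r.
by rewrite mulrA -[_ * _ * _ ^+ _]mulrA -exprMn mulrNN mul1r expr1n mulr1 mulN1r.
Qed.

End signs.

(** * Integrability and derivative for both signs of the argument *)

Section main.
Variable R : realType.
Local Notation RM := (measurableTypeR R).
Local Notation mu := (@lebesgue_measure R).
Variables (Y : R) (x c om : R -> R).
Hypothesis rot : rotation Y x c om.
Hypothesis xN : forall t, x (- t) = - x t.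
Hypothesis omN : forall t, om (- t) = om t.
Variables (fs : seq (R -> R)) (f3 f0 g : R -> R) (n : nat).
Hypotheses (mfs : measurable_word fs)
  (mf3 : measurable_fun setT (f3 : RM -> RM))
  (mf0 : measurable_fun setT (f0 : RM -> RM))
  (mg : measurable_fun setT (g : RM -> RM)).
Hypotheses (ofs : forall f, f \in fs -> odd_nneg Y f) (of3 : odd_nneg Y f3)
  (of0 : odd_nneg Y f0) (eg : even_nneg Y g).
Hypothesis fsE : forall t, 0 < t < Y -> \sum_(f <- fs) f t = om t / (x t * c t).
Hypothesis f3E : forall t, 0 < t < Y -> f3 t = om t / x t.
Hypothesis f0E : forall t, 0 < t < Y -> f0 t = c t * om t / x t.
Hypothesis gE : forall t, 0 < t < Y -> g t = b n (x t) * om t.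

Local Notation A := (letters fs f3 f0 g).

(** This is the shape that the parity lemmas expect: odd forms followed by one even form. *)
Lemma letters_rcons s w : w \in A s ->
  exists2 u, w = rcons u g & forall f, f \in u -> odd_nneg Y f.
Proof.
elim: s w => [|si s ih] w /=.
  by rewrite inE => /eqP ->; exists [::].
move=> /allpairsP[[u v] /= [ui /ih[v' -> ov] ->]].
exists (u ++ v'); first by rewrite rcons_cat.
move=> f; rewrite mem_cat => /orP[|/ov//].
move: ui; rewrite /letter; case: ifP => _.
  by move=> /mapP[h hfs ->]; rewrite inE => /eqP ->; exact: ofs.
rewrite inE => /eqP ->; rewrite in_cons mem_cat mem_nseq inE.
by move=> /or3P[/eqP ->|/andP[_ /eqP ->]|/eqP ->].
Qed.

Lemma abs_integral_letters s y : all (leq 1) s -> 0 < y < Y ->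
  (\sum_(w <- A s) abs_integral w y =
   \int[mu]_(t in `]0%R, y[) ((om t)%:E * bseries (coef R n s) (x t)))%E.
Proof.
move=> s0 yY.
apply: (@abs_iterated_letters_om R Y x c om rot fs f3 f0 g n) => //.
- move=> t tY; rewrite -fsE// !big_seq; apply: eq_bigr => f ffs.
  by rewrite ger0_norm//; apply: (ofs ffs).2.
- by move=> t tY; rewrite -f3E// ger0_norm//; exact: of3.2.
- by move=> t tY; rewrite -f0E// ger0_norm//; exact: of0.2.
- by move=> t tY; rewrite -gE// ger0_norm//; exact: eg.2.
Qed.

Let G s t := fine (bseries (coef R n s) (x t)) * om t.

Lemma continuous_G s t : all (leq 1) s -> `|t| < Y -> {for t, continuous (G s)}.
Proof.
move=> s0 tY; apply: cvgM; last exact: (rot_om rot).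
apply: (@continuous_comp _ _ _ x (fun z => fine (bseries (coef R n s) z))).
  exact: (rot_cx rot).
apply: continuous_bseries; [exact: coef_ge0|exact: bsummable_coef|].
exact: (rot_x_lt1 rot).
Qed.

Lemma integral_G s y : all (leq 1) s -> 0 < y < Y ->
  (\int[mu]_(t in `]0%R, y[) ((om t)%:E * bseries (coef R n s) (x t)) =
   (\int[mu]_(t in `]0%R, y[) G s t)%R%:E)%E.
Proof.
move=> s0 yY; rewrite /Rintegral fineK.
  apply: eq_integral => t /set_mem /(rot_oo yY) tY.
  rewrite /G EFinM fineK 1?muleC//.
  apply: bsummable_fin; [exact: coef_ge0|exact: bsummable_coef|].
  exact: (rot_x_lt1 rot).
apply: integrable_fin_num => //.
apply: (@integrableS _ _ _ mu `[0, y]%classic) => //.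
  exact: subset_itv_oo_cc.
apply: continuous_itv_integrable => t /(rot_seg yY) tY.
exact: continuous_G.
Qed.

Lemma abs_integral_lettersN s w y : w \in A s -> abs_integral w (- y) = abs_integral w y.
Proof.
move=> wA; apply: abs_integralN.
  exact: (measurable_letters mfs mf3 mf0 mg wA).
have [u -> ou] := letters_rcons wA.
move=> f; rewrite mem_rcons in_cons => /orP[/eqP ->|/ou[fN _]] t.
  by rewrite eg.1.
by rewrite fN normrN.
Qed.

(** For [y > 0] the integral is one nonnegative summand of a finite sum; negative [y] follow by
    parity. *)
Lemma abs_integral_lty s w y : all (leq 1) s -> w \in A s -> `|y| < Y ->
  (abs_integral w y < +oo)%E.
Proof.
move=> s0 wA.
have pos z : 0 < z < Y -> (abs_integral w z < +oo)%E.
  move=> zY; have := abs_integral_letters s0 zY.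
  rewrite (perm_big _ (perm_to_rem wA)) big_cons/= integral_G// => e.
  rewrite ltey_eq; apply/orP; left.
  have : (abs_integral w z + \sum_(j <- rem w (A s)) abs_integral j z)%E \is a fin_num.
    by rewrite e.
  by rewrite fin_numD => /andP[].
move=> yY; have [y0|y0|->] := ltgtP y 0.
- by rewrite -(abs_integral_lettersN _ wA); apply: pos; rewrite oppr_gt0 y0 -(ltr0_norm y0).
- by apply: pos; rewrite y0 -(gtr0_norm y0).
have mw := measurable_letters mfs mf3 mf0 mg wA.
have [u wE _] := letters_rcons wA.
(* The word is nonempty since it ends in [g], and the range of its outermost variable is empty. *)
have -> : abs_integral w 0 = 0%E.
  case: w {wA pos wE} mw wE => [|f v mw _]; first by case: u.
  by rewrite abs_integral_cons// segE// set_itvoo0 integral_set0.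
exact: ltry.
Qed.

Lemma letters_integrable s y : all (leq 1) s -> `|y| < Y ->
  iterated_integrable (A s) y.
Proof.
move=> s0 yY w wA; apply/integrableP; split.
  apply: measurable_funTS; apply/measurable_EFinP.
  exact: measurable_word_integrand (measurable_letters mfs mf3 mf0 mg wA).
exact: abs_integral_lty s0 wA yY.
Qed.

Lemma iterated_integral_pos s y : all (leq 1) s -> 0 < y < Y ->
  iterated_integral (A s) y = fine (\sum_(w <- A s) abs_integral w y)%E.
Proof.
move=> s0 yY; have yY' : `|y| < Y by case/andP: yY => y0 ?; rewrite gtr0_norm.
rewrite [in RHS]big_seq -sum_fine; last first.
  move=> w wA; rewrite ge0_fin_numE ?abs_integral_ge0//.
  exact: abs_integral_lty s0 wA yY'.
rewrite /iterated_integral big_seq; apply: eq_bigr => w wA.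
apply: (@word_integral_pos _ Y) => //; have [u -> ou] := letters_rcons wA.
by move=> f; rewrite mem_rcons in_cons => /orP[/eqP ->|/ou[]//]; exact: eg.2.
Qed.

Lemma iterated_integralN s y : all (leq 1) s -> `|y| < Y ->
  iterated_integral (A s) (- y) = - iterated_integral (A s) y.
Proof.
move=> s0.
have pos z : 0 < z < Y -> iterated_integral (A s) (- z) = - iterated_integral (A s) z.
  move=> zY; rewrite /iterated_integral -sumrN !big_seq; apply: eq_bigr => w wA.
  rewrite (@word_integral_pos _ Y w z)//; last first.
    have [u -> ou] := letters_rcons wA.
    by move=> f; rewrite mem_rcons in_cons => /orP[/eqP ->|/ou[]//]; exact: eg.2.
  rewrite -(abs_integral_lettersN _ wA).
  have [u -> ou] := letters_rcons wA.
  by rewrite (word_integral_neg ou eg).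
move=> yY; have [y0|y0|->] := ltgtP y 0.
- have ny : 0 < - y < Y by rewrite oppr_gt0 y0 -(ltr0_norm y0).
  by rewrite -[in RHS](opprK y) (pos _ ny) opprK.
- by apply: pos; rewrite y0 -(gtr0_norm y0).
rewrite oppr0; suff -> : iterated_integral (A s) 0 = 0 by rewrite oppr0.
rewrite /iterated_integral big_seq big1// => w wA.
rewrite /word_integral lexx mul1r /Rintegral integral0_eq//.
have [u -> _] := letters_rcons wA.
move=> t; rewrite /simplex/= lexx => /path_gt0; by rewrite ltxx.
Qed.

Lemma derive_letters s (y : R) : all (leq 1) s -> `|y| < Y ->
  is_derive y 1 (iterated_integral (A s))
    (fine (bseries (coef R n s) (x y)) * om y).
Proof.
move=> s0; apply: (@derive_odd_primitive R Y (G s)).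
- by move=> t; exact: continuous_G.
- move=> t tY; rewrite /G omN xN; congr (fine _ * _).
  by apply/eqP; rewrite eq_le !le_bseries ?normrN//; exact: coef_ge0.
- by move=> z zY; rewrite iterated_integral_pos// abs_integral_letters// integral_G.
- by move=> z; exact: iterated_integralN.
Qed.

Lemma letters_integrable_derive s (y : R) : all (leq 1) s -> `|y| < Y ->
  iterated_integrable (A s) y /\
  is_derive y 1 (iterated_integral (A s))
    (fine (bseries (coef R n s) (x y)) * om y).
Proof. by move=> s0 yY; split; [exact: letters_integrable|exact: derive_letters]. Qed.

End main.

(** * The two families of forms *)

Section instances.
Variable R : realType.
Local Notation RM := (measurableTypeR R).

(** The forms are total functions, with [0^-1 = 0] at their poles. Measurability combines continuity
    away from 0 with the measurable singleton 0. *)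
Lemma measurable_invr : measurable_fun setT (GRing.inv : RM -> RM).
Proof.
rewrite -(setvU [set (0 : RM)]); apply/measurable_funU => //.
  exact: measurableC.
split; last exact: measurable_fun_set1.
apply: open_continuous_measurable_fun.
  rewrite (_ : ~` _ = [set t : R | t != 0]); first exact: open_neq.
  by apply/seteqP; split => t /= /eqP.
by move=> t; rewrite inE/= => /eqP t0; exact: inv_continuous.
Qed.

Lemma measurable_funV (f : RM -> RM) :
  measurable_fun setT f -> measurable_fun setT (fun t => (f t)^-1 : RM).
Proof. exact: (measurableT_comp measurable_invr). Qed.

Lemma measurable_sin : measurable_fun setT (@sin R : RM -> RM).
Proof. by apply: continuous_measurable_fun; exact: continuous_sin. Qed.

Lemma measurable_cos : measurable_fun setT (@cos R : RM -> RM).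
Proof. by apply: continuous_measurable_fun; exact: continuous_cos. Qed.

Lemma measurable_sqrt1B2 :
  measurable_fun setT (fun t : RM => Num.sqrt (1 - t ^+ 2) : RM).
Proof.
apply: continuous_measurable_fun => t.
apply: (@continuous_comp _ _ _ (fun t : R => 1 - t ^+ 2) Num.sqrt).
  by apply: cvgB; [exact: cvg_cst|exact: exprn_continuous].
exact: sqrt_continuous.
Qed.

Lemma measurable_b n (f : RM -> RM) :
  measurable_fun setT f -> measurable_fun setT (fun t => b n (f t) : RM).
Proof.
by move=> mf; apply: measurable_funM => //; exact: measurable_funX.
Qed.

Lemma sin2E (t : R) : sin (2 * t) = 2 * (sin t * cos t).
Proof. by rewrite mulr_natl sin_mulr2n mulr_natl mulrC. Qed.

Lemma trig_form_derive n (s : seq nat) (y : R) : all (leq 1) s -> `|y| < pi / 2 ->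
  iterated_integrable (trig_form R s n) y /\
  is_derive y 1 (iterated_integral (trig_form R s n))
    (fine (bseries (coef R n s) (sin y))).
Proof.
move=> s0 yY.
have mcsc : measurable_fun setT (@csc R : RM -> RM).
  exact: (measurable_funV measurable_sin).
have mcot : measurable_fun setT (@cot R : RM -> RM).
  apply: measurable_funM; first exact: measurable_cos.
  exact: (measurable_funV measurable_sin).
have mb : measurable_fun setT (fun t : RM => b n (sin t) : RM).
  exact: (measurable_b n measurable_sin).
have mh1 : measurable_word [:: fun t : R => 2 * csc (2 * t)].
  move=> f; rewrite inE => /eqP ->; apply: measurable_funM => //.
  apply: (measurableT_comp mcsc); exact: measurable_funM.
have sc0 (t : R) : 0 < t < pi / 2 -> 0 < sin t /\ 0 < cos t.
  move=> tY; split; first exact: sin_gt0_pihalf.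
  by apply: (rot_c_gt0 (@rotation_trig R)); case/andP: tY => ? ?; rewrite gtr0_norm.
have oh1 f : f \in [:: fun t : R => 2 * csc (2 * t)] -> odd_nneg (pi / 2) f.
  rewrite inE => /eqP ->; split => [t|t /sc0[s0' c0]]; rewrite /csc.
    by rewrite mulrN sinN invrN mulrN.
  by rewrite sin2E mulr_ge0// invr_ge0 !mulr_ge0// ltW.
have ocsc : odd_nneg (pi / 2) (@csc R).
  split => [t|t /sc0[s0' c0]]; rewrite /csc; first by rewrite sinN invrN.
  by rewrite invr_ge0 ltW.
have ocot : odd_nneg (pi / 2) (@cot R).
  split => [t|t /sc0[s0' c0]]; rewrite /cot; first by rewrite sinN cosN invrN mulrN.
  by rewrite divr_ge0 ?ltW.
have eb : even_nneg (pi / 2) (fun t : R => b n (sin t)).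
  split => [t|t _]; last exact: b_ge0.
  by rewrite sinN -b_norm normrN b_norm.
rewrite -[fine _]mulr1.
(* With these forms [trig_form] is [letters] by conversion; the single form for s = 1 is
   [2 csc(2t) = 1 / (sin t cos t)]. *)
apply: (@letters_integrable_derive R (pi / 2) (@sin R) (@cos R) (fun=> 1)
  (@rotation_trig R) (@sinN R) (fun=> erefl) _ _ _ _ n
  mh1 mcsc mcot mb oh1 ocsc ocot eb) => //.
- move=> t /sc0[s0' c0]; rewrite big_seq1 /csc sin2E; field.
  by rewrite !gt_eqF.
- by move=> t _; rewrite /csc div1r.
- by move=> t _; rewrite /cot mulr1.
- by move=> t _; rewrite mulr1.
Qed.

Lemma nontrig_form_derive n (s : seq nat) (y : R) : all (leq 1) s -> `|y| < 1 ->
  iterated_integrable (nontrig_form R s n) y /\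
  is_derive y 1 (iterated_integral (nontrig_form R s n))
    (fine (bseries (coef R n s) y) * omega1 y).
Proof.
move=> s0 yY.
have rot := @rotation_asin R.
have m0 : measurable_fun setT (@omega0 R : RM -> RM) by exact: measurable_funV.
have m1 : measurable_fun setT (@omega1 R : RM -> RM).
  exact: (measurable_funV measurable_sqrt1B2).
have m2 : measurable_fun setT (@omega2 R : RM -> RM).
  apply: measurable_funM => //; apply: measurable_funV.
  by apply: measurable_funB => //; exact: measurable_funX.
have m3 : measurable_fun setT (@omega3 R : RM -> RM).
  by apply: measurable_funV; apply: measurable_funM => //; exact: measurable_sqrt1B2.
have mb : measurable_fun setT (fun t : RM => b n t * omega1 t : RM).
  by apply: measurable_funM => //; exact: measurable_b.
have mh : measurable_word [:: @omega0 R; @omega2 R].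
  by move=> f; rewrite !inE => /orP[] /eqP ->.
have c0 (t : R) : 0 < t < 1 -> 0 < t /\ 0 < Num.sqrt (1 - t ^+ 2).
  move=> /andP[t0 t1]; split => //.
  by apply: (rot_c_gt0 rot); rewrite gtr0_norm.
have q0 (t : R) : 0 < t < 1 -> 0 < 1 - t ^+ 2.
  by move=> /c0[_]; rewrite sqrtr_gt0.
have o0 : odd_nneg 1 (@omega0 R).
  split => [t|t /c0[t0 _]]; rewrite /omega0; first by rewrite invrN.
  by rewrite invr_ge0 ltW.
have o2 : odd_nneg 1 (@omega2 R).
  split => [t|t t01]; rewrite /omega2; first by rewrite sqrrN mulNr.
  by rewrite divr_ge0// ltW ?q0//; case/andP: t01.
have o3 : odd_nneg 1 (@omega3 R).
  split => [t|t /c0[t0 s0']]; rewrite /omega3; first by rewrite sqrrN mulNr invrN.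
  by rewrite invr_ge0 mulr_ge0 ?ltW.
have oh f : f \in [:: @omega0 R; @omega2 R] -> odd_nneg 1 f.
  by rewrite !inE => /orP[] /eqP ->.
have omN (t : R) : omega1 (- t) = omega1 t by rewrite /omega1 sqrrN.
have eb : even_nneg 1 (fun t : R => b n t * omega1 t).
  split => [t|t /c0[_ s0']]; last by rewrite mulr_ge0 ?b_ge0// invr_ge0 ltW.
  by rewrite omN -b_norm normrN b_norm.
apply: (@letters_integrable_derive R 1 id _ (@omega1 R) rot (fun=> erefl) omN
  _ _ _ _ n mh m3 m0 mb oh o3 o0 eb) => //.
- move=> t t01; have [t0 s0'] := c0 t t01.
  rewrite big_cons big_seq1 /omega0 /omega2 /omega1.
  (* [omega1] and [c] each supply one root; squared, they match
     [1/t + t/(1 - t^2) = 1/(t (1 - t^2))]. *)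
  rewrite [RHS](_ : _ = (t * Num.sqrt (1 - t ^+ 2) ^+ 2)^-1).
    rewrite sqr_sqrtr ?ltW ?q0//; field.
    by rewrite !gt_eqF ?q0.
  by field; rewrite !gt_eqF.
- by move=> t t01; have [t0 s0'] := c0 t t01; rewrite /omega3 /omega1 invfM mulrC.
- move=> t t01; have [t0 s0'] := c0 t t01; rewrite /omega0 /omega1 mulfV ?mul1r//.
  by rewrite gt_eqF.
Qed.

End instances.

Theorem theorem2p3 (R : realType) (n d : nat) (s : d.-tuple nat)
    (d_gt0 : (0 < d)%N) (s_gt0 : forall i : 'I_d, (0 < tnth s i)%N) :
  (forall y : R, `|y| < pi / 2 ->
    [/\ iterated_integrable (trig_form R s n) y,
        derivable (iterated_integral (trig_form R s n)) y 1 &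
        nested_sum s n (sin y)
          = (derive1 (iterated_integral (trig_form R s n)) y)%:E ]) /\
  (forall x : R, `|x| < 1 ->
    [/\ iterated_integrable (nontrig_form R s n) x,
        derivable (iterated_integral (nontrig_form R s n)) x 1 &
        nested_sum s n x
          = (Num.sqrt (1 - x ^+ 2)
             * derive1 (iterated_integral (nontrig_form R s n)) x)%:E ]).
Proof.
have s0 : all (leq 1) s by apply/all_tnthP.
have a0 := @coef_ge0 R n s; have sa := @bsummable_coef R n s s0.
split=> [y yY|x x1].
  have [iy dy] := trig_form_derive n s0 yY.
  split; [exact: iy|by case: dy|].
  (* The derivative is known as the [fine] part of the series, which loses nothing because the
     series is finite for arguments of absolute value below 1. *)
  rewrite nested_sumE derive1E derive_val fineK//.
  exact: bsummable_fin a0 sa (rot_x_lt1 (@rotation_trig R) yY).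
have [ix dx] := nontrig_form_derive n s0 x1.
split; [exact: ix|by case: dx|].
(* The prefactor [sqrt (1 - x^2)] cancels the angular speed [omega1 x]. *)
rewrite nested_sumE derive1E derive_val mulrCA /omega1 mulfV ?mulr1.
  by rewrite fineK//; exact: bsummable_fin a0 sa x1.
by rewrite gt_eqF// (rot_c_gt0 (@rotation_asin R)).
Qed.
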